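(* For any integer $n\geq 2$ there exists an element $g_n\in\mathbf F(4n-3)$ such that $$n^2-n+1\leq \|g_n\|\leq 4n^2-8n+5\qquad\text{and}\qquad 2n\leq \|g_n^2\|\leq 8n-4.$$
   Context: For an integer $d\ge 0$, $\mathbf F(d)$ denotes the free group on $d$ free generators. For a free group with fixed set $S$ of free generators, $\|g\|$ denotes the smallest integer $m\ge0$ such that $g$ is a product of $m$ elements, each of which is a conjugate of an element of $S\cup S^{-1}$ (the conjugation-invariant word norm). *)

(* Defs.v *)
From HB Require Import structures.
From mathcomp Require Import all_boot.
From mathcomp Require Import boolp.

Set Implicit Arguments.
Unset Strict Implicit.
Unset Printing Implicit Defensive.

Local Open Scope group_scope.

Section FreeGroup.
Variable S : choiceType.

(* (s, false) is the generator s, and (s, true) is its formal inverse. *)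
Definition letter : Type := (S * bool)%type.
Implicit Types (a b : letter) (u v w : seq letter).

Definition linv a : letter := (a.1, ~~ a.2).

Definition reduced w : bool := sorted (fun a b => a != linv b) w.

Definition push a w : seq letter :=
  if w is b :: w' then if a == linv b then w' else a :: w else [:: a].

Definition reduce w : seq letter := foldr push [::] w.

Definition winv w : seq letter := rev (map linv w).

Lemma linvK : involutive linv.
Proof. by case=> s b; rewrite /linv /= negbK. Qed.

Lemma eq_linv a b : (a == linv b) = (b == linv a).
Proof. by apply/eqP/eqP=> ->; rewrite linvK. Qed.

Lemma push_reduced a w : reduced w -> reduced (push a w).
Proof.
case: w => [//|b w] rw /=; case: ifP => [_|/= ->]; last exact: rw.
exact: path_sorted rw.
Qed.

Lemma foldr_push_reduced u w : reduced w -> reduced (foldr push w u).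
Proof. by move=> rw; elim: u => //= a u; apply: push_reduced. Qed.

Lemma reduce_reduced w : reduced (reduce w).
Proof. exact: foldr_push_reduced. Qed.

Lemma pushK a w : reduced w -> push (linv a) (push a w) = w.
Proof.
case: w => [|b w] rw /=; first by rewrite eqxx.
case: ifP => [/eqP->|_]; last by rewrite /= eqxx.
rewrite linvK; case: w rw => [//|c w] /= /andP[bc _].
by rewrite (negbTE bc).
Qed.

Lemma reduce_id w : reduced w -> reduce w = w.
Proof.
elim: w => [//|a w IH] rw /=; rewrite -/(reduce w) IH; last first.
  exact: path_sorted rw.
by case: w rw {IH} => [//|b w] /= /andP[/negbTE-> _].
Qed.

Lemma foldr_push a u w : reduced w ->
  foldr push w (push a u) = push a (foldr push w u).
Proof.
case: u => [//|b u] rw /=; case: ifP => // /eqP->.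
by rewrite pushK // foldr_push_reduced.
Qed.

Lemma foldr_push_reduce u w : reduced w ->
  foldr push w (reduce u) = foldr push w u.
Proof. by move=> rw; elim: u => //= a u IH; rewrite foldr_push // IH. Qed.

Lemma reduce_cat u v : reduce (u ++ v) = foldr push (reduce v) u.
Proof. exact: foldr_cat. Qed.

Lemma reduce_catl u v : reduce (reduce u ++ v) = reduce (u ++ v).
Proof. by rewrite !reduce_cat foldr_push_reduce ?reduce_reduced. Qed.

Lemma reduce_catr u v : reduce (u ++ reduce v) = reduce (u ++ v).
Proof. by rewrite !reduce_cat (reduce_id (reduce_reduced v)). Qed.

Lemma winvK : involutive winv.
Proof.
by move=> w; rewrite /winv map_rev revK -map_comp (eq_map linvK) map_id.
Qed.

Lemma winv_reduced w : reduced w -> reduced (winv w).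
Proof.
rewrite /reduced /winv rev_sorted sorted_map.
by apply: sub_sorted => a b /= ab; rewrite linvK eq_sym.
Qed.

Lemma reduce_winvl w : reduce (winv w ++ w) = [::].
Proof.
elim: w => [//|a w IH].
rewrite /winv /= rev_cons cat_rcons reduce_cat /= -/(reduce w).
by rewrite pushK ?reduce_reduced // -reduce_cat.
Qed.

Record freeGroup : Type := FreeGroup { fword : seq letter; _ : reduced fword }.

HB.instance Definition _ := [isSub for fword].
HB.instance Definition _ := [Choice of freeGroup by <:].

Implicit Types x y z : freeGroup.

Definition fmk w : freeGroup := FreeGroup (reduce_reduced w).
Definition fone : freeGroup := fmk [::].
Definition fmul x y : freeGroup := fmk (fword x ++ fword y).
Definition finv x : freeGroup := fmk (winv (fword x)).

Lemma fword_reduced x : reduced (fword x). Proof. exact: valP x. Qed.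

Lemma fmulA : associative fmul.
Proof.
by move=> x y z; apply: val_inj; rewrite /= reduce_catl reduce_catr catA.
Qed.

Lemma fmul1 : left_id fone fmul.
Proof. by move=> x; apply: val_inj; rewrite /= reduce_id ?fword_reduced. Qed.

Lemma fmulx1 : right_id fone fmul.
Proof.
by move=> x; apply: val_inj; rewrite /= cats0 reduce_id ?fword_reduced.
Qed.

Lemma fmulV : left_inverse fone finv fmul.
Proof.
by move=> x; apply: val_inj; rewrite /= reduce_catl reduce_winvl.
Qed.

Lemma fmulxV : right_inverse fone finv fmul.
Proof.
move=> x; apply: val_inj.
by rewrite /= reduce_catr -{1}(winvK (fword x)) reduce_winvl.
Qed.

HB.instance Definition _ :=
  isGroup.Build freeGroup fmulA fmul1 fmulx1 fmulV fmulxV.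

Definition gen (s : S) : freeGroup := fmk [:: (s, false)].

Lemma fmk_cat u v : fmk (u ++ v) = fmk u * fmk v.
Proof. by apply: val_inj; rewrite /= reduce_catl reduce_catr. Qed.

Lemma fmk_letter a : fmk [:: a] = if a.2 then (gen a.1)^-1 else gen a.1.
Proof. by apply: val_inj; case: a => s []. Qed.

Lemma fmk_prod w :
  fmk w = \prod_(a <- w) (if a.2 then (gen a.1)^-1 else gen a.1).
Proof.
elim: w => [|a w IH]; first by rewrite big_nil; apply: val_inj.
by rewrite big_cons -fmk_letter -IH -fmk_cat.
Qed.

Lemma fwordK x : fmk (fword x) = x.
Proof. by apply: val_inj; rewrite /= reduce_id ?fword_reduced. Qed.

Section UniversalProperty.
Variables (G : groupType) (f : S -> G).

Definition free_lift x : G :=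
  \prod_(a <- fword x) (if a.2 then (f a.1)^-1 else f a.1).

Lemma free_lift_gen s : free_lift (gen s) = f s.
Proof. by rewrite /free_lift big_seq1. Qed.

Lemma free_lift_reduce w :
  \prod_(a <- reduce w) (if a.2 then (f a.1)^-1 else f a.1)
    = \prod_(a <- w) (if a.2 then (f a.1)^-1 else f a.1).
Proof.
elim: w => [//|a w IH]; rewrite big_cons -IH /= -/(reduce w).
case: (reduce w) => [|b v] /=; first by rewrite big_seq1 big_nil mulg1.
case: ifP => [/eqP->|_]; last by rewrite !big_cons.
by rewrite big_cons; case: b => s [] /=; rewrite mulgA ?mulgV ?mulVg mul1g.
Qed.

Lemma free_liftM x y : free_lift (x * y) = free_lift x * free_lift y.
Proof. by rewrite {1}/free_lift free_lift_reduce big_cat. Qed.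

Lemma free_lift_unique (h : freeGroup -> G) :
  (forall x y, h (x * y) = h x * h y) -> (forall s, h (gen s) = f s) ->
  h =1 free_lift.
Proof.
move=> hM hgen x.
have h1 : h 1 = 1 by apply: (mulgI (h 1)); rewrite -hM !mulg1.
have hV y : h y^-1 = (h y)^-1.
  by apply: (mulgI (h y)); rewrite -hM !mulgV.
rewrite -{1}(fwordK x) fmk_prod (big_morph h hM h1).
by apply: eq_bigr => -[s []] _ /=; rewrite ?hV hgen.
Qed.

End UniversalProperty.

Definition conj_gen x : Prop :=
  exists (s : S) (y : freeGroup), x = gen s ^ y \/ x = (gen s)^-1 ^ y.

Definition prod_of_conj_gens x (m : nat) : Prop :=
  exists t : m.-tuple freeGroup,
    (forall i, conj_gen (tnth t i)) /\ x = \prod_(i < m) tnth t i.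

Lemma prod_of_conj_gens_exists x : exists m, `[< prod_of_conj_gens x m >].
Proof.
exists (size (fword x)); apply/asboolP.
pose F a := if a.2 then (gen a.1)^-1 else gen a.1.
exists (map_tuple F (in_tuple (fword x))); split=> [i|].
  rewrite tnth_map /F; case: (tnth _ i) => s b /=; exists s, 1.
  by rewrite !conjg1; case: b; [right|left].
rewrite -{1}(fwordK x) fmk_prod (big_tnth _ _ (fword x)).
by apply: eq_bigr => i _; rewrite tnth_map.
Qed.

Definition conj_norm x : nat := ex_minn (prod_of_conj_gens_exists x).

End FreeGroup.

(* Main.v *)
Require Import Defs.
From mathcomp Require Import all_boot all_algebra boolp zify.

Set Implicit Arguments.
Unset Strict Implicit.
Unset Printing Implicit Defensive.

(** Write |g| for the conjugation-invariant norm.  The heart of the proof is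
    that a free group on two letters contains elements x of every norm
    m >= 2 whose square has norm at most 4 (bounded_square_any_norm).  For
    n >= 3 the theorem follows with g = x r^n, where |x| = n^2 + 1 and r is a
    third generator: |g| differs from |x| by at most n, the exponent sum of r
    in g^2 is 2n, and g^2 is x^2 times two conjugates of r^n, so that
    2n <= |g^2| <= 4 + 2n.  For n = 2 a cube of a generator will do.

    The elements x come from simple one-sided closed curves in a projective
    plane with four marked points.  Cutting along such a curve leaves a disc
    whose boundary reads x^2, so x^2 = e1 e2 e3 e4 with every e_i a conjugate
    of a letter.  Pushing the curve over the last marked point yields another
    such curve, namely x' = x e4^-1.  Before the push the marked points may be
    twisted: with D = e2 e3 e4, replacing e_i by its conjugate D^n e_i D^-n
    for i = 2, 3, 4 does not change the product.  Hence the square of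
    x' = x D^n e4^-1 D^-n is again a product of four conjugates of letters,
    for every n (slide).  Clearly |x'| <= |x| + 1, and the claim is that
    |x'| = |x| + 1 as soon as n is large (conj_norm_slide); repeating the move
    then reaches every norm.

    To bound |x'| from below, recall that the norm of an element is the least
    number of letters whose deletion from a given word makes that word trivial
    (trivializable_norm).  The power D^n is too long to be destroyed by |x| + 1
    deletions, so an optimal deletion has to treat x and e4^-1 separately,
    except that they may exchange a power of D:
      |x D^n e4^-1 D^-n| >= |x D^j| + |e4 D^j|  for some integer j
    (conj_norm_far_conj).  Exponent sums give |e4 D^j| >= |3j + 1|, whereas
    |x D^j| >= |x| - 3|j|.  This is enough for j >= 0; for j < 0 one gains from
    x D^-1 = x^-1 e1, which shows that the first factor D^-1 decreases the norm
    of x by at most 1 instead of 3.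

    The separation statement is proved for products of many powers of a
    cyclically reduced word P interleaved with short entries
    (large_exponents_clustered): if the exponents are large, an optimal set of
    deletions spends some of them on turning one interior entry into an element
    commuting with P.  The induction is on the norm.  A deletion next to an entry
    is absorbed by that entry, and a deletion deep inside a power of P creates a
    new entry.  When no deletion is left, the product is trivial, and Baumslag's
    lemma (trivial_block_prod) says that an interior entry commutes with P. *)

(** * The norm and its distance *)
Section Norm.
Local Open Scope group_scope.
Variable S : choiceType.
Implicit Types (x y z g h c : freeGroup S) (u v w : seq (letter S)).
Implicit Types (a b : letter S).
Local Notation F := (freeGroup S).
Local Notation N := (@conj_norm S).

Lemma conj_norm_seq g :
  exists cs : seq F, [/\ {in cs, forall c, conj_gen c},
    g = \prod_(c <- cs) c & size cs = N g].
Proof.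
rewrite /conj_norm; case: ex_minnP => m /asboolP [t [ct gE]] _.
exists t; split; last by rewrite size_tuple.
- by move=> c /tnthP [i ->]; apply: ct.
- by rewrite gE big_tuple.
Qed.
Lemma conj_norm_prod (cs : seq F) :
  {in cs, forall c, conj_gen c} -> N (\prod_(c <- cs) c) <= size cs.
Proof.
move=> ccs; rewrite /conj_norm; case: ex_minnP => m _; apply.
apply/asboolP; exists (in_tuple cs); split=> [i|].
  by apply: ccs; apply: mem_tnth.
by rewrite (big_tnth _ _ cs).
Qed.

Lemma conj_norm1 : N 1 = 0.
Proof.
by apply/eqP; rewrite -leqn0; have /= := @conj_norm_prod [::]; rewrite big_nil; apply.
Qed.

Lemma conj_norm0 g : N g = 0 -> g = 1.
Proof.
by have [[|c cs] [_ gE <-] //] := conj_norm_seq g; rewrite gE big_nil.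
Qed.

Lemma conj_normM g h : N (g * h) <= N g + N h.
Proof.
have [cs [ccs -> <-]] := conj_norm_seq g.
have [ds [cds -> <-]] := conj_norm_seq h.
rewrite -big_cat -size_cat; apply: conj_norm_prod => c.
by rewrite mem_cat => /orP [/ccs|/cds].
Qed.

Lemma conj_genJ c x : conj_gen c -> conj_gen (c ^ x).
Proof. by case=> s [y [->|->]]; exists s, (y * x); rewrite !conjgM; [left|right]. Qed.

Lemma conj_genV c : conj_gen c -> conj_gen c^-1.
Proof.
by case=> s [y [->|->]]; exists s, y; rewrite -conjVg ?invgK; [right|left].
Qed.

Lemma conj_norm_gen c : conj_gen c -> N c <= 1.
Proof.
move=> cc; have /= := @conj_norm_prod [:: c]; rewrite big_seq1; apply.
by move=> d; rewrite inE => /eqP ->.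
Qed.

Lemma conj_normJ g x : N (g ^ x) = N g.
Proof.
have le h y : N (h ^ y) <= N h.
  have [cs [ccs hE <-]] := conj_norm_seq h; rewrite {1}hE {hE}.
  rewrite conjg_prod -(size_map (conjg^~ y)) -(big_map (conjg^~ y) xpredT id).
  by apply: conj_norm_prod => _ /mapP [c /ccs cc ->]; apply: conj_genJ.
by apply/eqP; rewrite eqn_leq le -{1}(conjgK x g) le.
Qed.

Lemma conj_normV g : N g^-1 = N g.
Proof.
have le h : N h^-1 <= N h.
  have [cs [ccs hE <-]] := conj_norm_seq h; rewrite {1}hE {hE}.
  elim: cs ccs => [|c cs IH] ccs /=; first by rewrite big_nil invg1 conj_norm1.
  rewrite big_cons invgM; apply: leq_trans (conj_normM _ _) _.
  rewrite -addn1; apply: leq_add; last first.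
    by apply/conj_norm_gen/conj_genV/ccs; rewrite mem_head.
  by apply: IH => d dcs; apply: ccs; rewrite inE dcs orbT.
by apply/eqP; rewrite eqn_leq le -{1}(invgK g) le.
Qed.

Definition dist g h := N (g^-1 * h).

Lemma distxx g : dist g g = 0.
Proof. by rewrite /dist mulVg conj_norm1. Qed.

Lemma distC g h : dist g h = dist h g.
Proof. by rewrite /dist -conj_normV invgM invgK. Qed.

Lemma dist_triangle h g k : dist g k <= dist g h + dist h k.
Proof.
rewrite /dist; apply: leq_trans (conj_normM _ _).
by rewrite !mulgA mulgK.
Qed.

Lemma distMl x g h : dist (x * g) (x * h) = dist g h.
Proof. by rewrite /dist invgM mulgA mulgVK. Qed.

Lemma distMr x g h : dist (g * x) (h * x) = dist g h.
Proof. by rewrite /dist invgM -(conj_normJ (g^-1 * h) x) conjgE !mulgA. Qed.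

Lemma distM g g' h h' : dist (g * h) (g' * h') <= dist g g' + dist h h'.
Proof. by rewrite -(distMr h g g') -(distMl g' h h'); apply: dist_triangle. Qed.

Lemma conj_norm_dist g h : N h <= N g + dist g h.
Proof. by apply: leq_trans (conj_normM _ _); rewrite mulVKg. Qed.

Lemma dist1g g : dist 1 g = N g.
Proof. by rewrite /dist invg1 mul1g. Qed.

Lemma fmk_nil : fmk [::] = 1 :> F. Proof. by []. Qed.

Lemma fmk_cons a w : fmk (a :: w) = fmk [:: a] * fmk w.
Proof. by rewrite -fmk_cat. Qed.

Lemma fmk_winv w : fmk (winv w) = (fmk w)^-1.
Proof.
apply: (mulIg (fmk w)); rewrite mulVg -fmk_cat; apply: val_inj.
by rewrite /= reduce_winvl.
Qed.

Lemma fmk_linv a : fmk [:: linv a] = (fmk [:: a])^-1.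
Proof. by rewrite -fmk_winv. Qed.

Lemma fmk_reduce w : fmk (reduce w) = fmk w.
Proof. by apply: val_inj; rewrite /= reduce_id // reduce_reduced. Qed.

Lemma fmk_eq u v : fmk u = fmk v -> reduce u = reduce v.
Proof. by move/(congr1 (@fword S)). Qed.

Lemma fmk_inj u v : reduced u -> reduced v -> fmk u = fmk v -> u = v.
Proof. by move=> ru rv /fmk_eq; rewrite !reduce_id. Qed.

Lemma size_reduce w : size (reduce w) <= size w.
Proof.
elim: w => //= a w IH; rewrite -/(reduce w).
case: (reduce w) IH => //= b v; case: ifP => //= _ H; lia.
Qed.

Lemma conj_gen_letter a x : conj_gen (fmk [:: a] ^ x).
Proof.
by apply: conj_genJ; rewrite fmk_letter; exists a.1, 1; rewrite !conjg1; case: a.2; [right|left].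
Qed.

Lemma conj_genE c : conj_gen c -> exists a x, c = fmk [:: a] ^ x.
Proof.
case=> s [x [->|->]]; first by exists (s, false), x; rewrite fmk_letter.
by exists (s, true), x; rewrite fmk_letter.
Qed.

Lemma reduce_cons_split w b q : reduce w = b :: q ->
  exists u v, [/\ w = u ++ b :: v, reduce u = [::] & reduce v = q].
Proof.
have [n] := ubnP (size w); elim: n w b q => // n IH [|c w] b q //= lt_wn.
rewrite -/(reduce w); case E: (reduce w) => [|d r] /=.
  by case=> <- <-; exists [::], w.
case: ifP => [/eqP -> rE|_ [<- <-]]; last by exists [::], w.
have [u [v [wE ru rv]]] := IH w d r lt_wn E.
have lt_vn: size v < n by move: lt_wn; rewrite wE size_cat /=; lia.
rewrite rE in rv; have [u' [v' [vE ru' rv']]] := IH v b q lt_vn rv.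
exists (linv d :: u ++ d :: u'), v'; split=> //.
  by rewrite wE vE /= -catA.
apply: (@fmk_eq _ [::]); rewrite fmk_cons fmk_cat (fmk_cons d) -(fmk_reduce u) -(fmk_reduce u').
by rewrite ru ru' !fmk_nil fmk_linv mul1g mulg1 mulVg.
Qed.

Definition one_deletion u v := exists w1 a w2, u = w1 ++ a :: w2 /\ v = w1 ++ w2.

(** If [u] equals a single letter, that letter survives the free reduction of
    [u], and the parts of [u] on both sides of it are trivial.  A conjugate of a
    letter reduces to this case by conjugating [u], one letter at a time. *)
Lemma one_deletion_conj_letter u a x : fmk u = fmk [:: a] ^ x ->
  exists2 v, one_deletion u v & fmk v = 1.
Proof.
have base w b : fmk w = fmk [:: b] -> exists2 v, one_deletion w v & fmk v = 1.
  move/fmk_eq/reduce_cons_split => [w1 [w2 [-> r1 r2]]].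
  exists (w1 ++ w2); first by exists w1, b, w2.
  by rewrite fmk_cat -fmk_reduce r1 -(fmk_reduce w2) r2 !fmk_nil mulg1.
rewrite -(fwordK x) -(revK (fword x)); elim: (rev (fword x)) u => [|c w IH] u.
  by rewrite /= fmk_nil conjg1; apply: base.
rewrite rev_cons -cats1 fmk_cat conjgM => uE.
have: fmk (c :: u ++ [:: linv c]) = fmk [:: a] ^ fmk (rev w).
  by rewrite fmk_cons fmk_cat fmk_linv uE 2!conjgE -!mulgA mulVKg mulgV mulg1 mulgA.
move/IH => [v [[|d w1] [e [w2 [/= E vE]]]]].
  move=> v1; case: E => ce w2E; apply: (base _ c).
  by move: v1; rewrite vE -w2E fmk_cat fmk_linv => /(canRL (mulgVK _)); rewrite mul1g.
case: E => dE E v1; subst d; case/lastP: w2 E vE => [|w2 f] E vE.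
  have uE': u = w1 by move: E; rewrite !cats1 => /rcons_inj; case.
  apply: (base _ (linv c)); move: v1; rewrite vE cats0 fmk_cons -uE' => H.
  by rewrite fmk_linv; apply/esym/mulg1_eq.
have uE': u = w1 ++ e :: w2.
  by move: E; rewrite cats1 -rcons_cons -rcons_cat => /rcons_inj; case.
have fE: f = linv c.
  by move: E; rewrite cats1 -rcons_cons -rcons_cat => /rcons_inj; case.
exists (w1 ++ w2); first by exists w1, e, w2.
move: v1; rewrite vE fE /= -rcons_cat -cats1 fmk_cons fmk_cat fmk_linv => H.
by apply/eqP; rewrite -(conjg_eq1 _ (fmk [:: c])^-1) conjgE invgK; apply/eqP.
Qed.
End Norm.

(** Linear arithmetic in which every norm and every distance is an unknown. *)
Ltac norm_lia :=
  repeat match goal with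
  | H : is_true (leq ?l ?r) |- _ => revert H
  | H : @conj_norm _ _ = _ |- _ => revert H
  end; clear;
  repeat match goal with
  | |- context [dist ?x ?y] => move: (dist x y) => ?
  | |- context [conj_norm ?x] => move: (conj_norm x) => ?
  end; lia.

(** * The norm counts deletions *)
Section Deletion.
Local Open Scope group_scope.
Variable S : choiceType.
Implicit Types (x y z g h c : freeGroup S) (u v w : seq (letter S)).
Implicit Types (a b : letter S).
Local Notation F := (freeGroup S).
Local Notation N := (@conj_norm S).

Lemma subseq_cat_split v u w : subseq v (u ++ w) ->
  exists v1 v2, [/\ v = v1 ++ v2, subseq v1 u & subseq v2 w].
Proof.
case/subseqP => m sm ->; rewrite -(cat_take_drop (size u) m) mask_cat.
  by exists (mask (take (size u) m) u), (mask (drop (size u) m) w); rewrite !mask_subseq.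
by rewrite size_takel // sm size_cat leq_addr.
Qed.

Lemma subseq_cons_split v u a : subseq v (a :: u) ->
  subseq v u \/ exists2 v', v = a :: v' & subseq v' u.
Proof.
case: v => [|b v]; first by left; apply: sub0seq.
by rewrite /=; case: eqP => [->|_]; [right; exists v | left].
Qed.

Lemma subseq_one_deletion u v : one_deletion u v -> subseq v u.
Proof.
by case=> w1 [a [w2 [-> ->]]]; apply: cat_subseq => //; apply: subseq_cons.
Qed.

Lemma size_one_deletion u v : one_deletion u v -> size u = (size v).+1.
Proof. by case=> w1 [a [w2 [-> ->]]]; rewrite !size_cat addnS. Qed.

Lemma dist_one_deletion u v : one_deletion u v -> dist (fmk u) (fmk v) <= 1.
Proof.
case=> w1 [a [w2 [-> ->]]]; rewrite !fmk_cat fmk_cons distMl.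
rewrite -{2}(mul1g (fmk w2)) distMr distC dist1g; apply: conj_norm_gen.
by rewrite -(conjg1 (fmk _)); apply: conj_gen_letter.
Qed.

Lemma one_deletion_cat u w v : one_deletion (u ++ w) v ->
  (exists2 u', one_deletion u u' & v = u' ++ w) \/
  (exists2 w', one_deletion w w' & v = u ++ w').
Proof.
elim: u v => [|c u IH] v dv; first by right; exists v.
case: dv => -[|d w1] [a [w2 [/= [cE E] ->]]].
  by left; exists u; rewrite ?E //; exists [::], c, u.
subst d; have [|[u' [w3 [b [w4 [-> ->]]] vE]]|[w' dw vE]] := IH (w1 ++ w2).
- by exists w1, a, w2.
- by left; exists (c :: w3 ++ w4); rewrite /= ?vE //; exists (c :: w3), b, w4.
- by right; exists w'; rewrite /= ?vE.
Qed.

Definition trivializable w k :=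
  exists v, [/\ subseq v w, fmk v = 1 & size w <= size v + k].

(** When only one letter of the cancelling pair is deleted, the other one
    cancels against some letter of the rest; that letter is deleted instead. *)
Lemma trivializable_cancel u a r k :
  trivializable (u ++ a :: linv a :: r) k -> trivializable (u ++ r) k.
Proof.
have one v1 b v2 : fmk (v1 ++ b :: v2) = 1 ->
    exists2 v', one_deletion (v1 ++ v2) v' & fmk v' = 1.
  rewrite fmk_cat fmk_cons => H.
  apply: (@one_deletion_conj_letter _ _ (linv b) (fmk v1)^-1).
  have {}H : fmk v2 = (fmk [:: b])^-1 * (fmk v1)^-1.
    by apply: (mulgI (fmk [:: b])); rewrite mulVKg; apply/esym/mulg1_eq.
  by rewrite fmk_cat H fmk_linv conjgE invgK.
case=> v [/subseq_cat_split [v1 [v2 [-> s1 s2]]] v1E].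
have fin q b : subseq q r -> fmk (v1 ++ b :: q) = 1 ->
    size (u ++ a :: linv a :: r) <= size (v1 ++ b :: q) + k -> trivializable (u ++ r) k.
  move=> sq /one [v' dv v'1] sz; exists v'; split=> //.
    exact: subseq_trans (subseq_one_deletion dv) (cat_subseq s1 sq).
  move: sz (size_one_deletion dv); rewrite !size_cat /=. lia.
case: (subseq_cons_split s2) v1E => [|[q ->]].
  case/subseq_cons_split => [s2'|[q -> sq]]; last exact: fin.
  move=> v1E sz; exists (v1 ++ v2); split=> //; first exact: cat_subseq.
  by move: sz; rewrite !size_cat /=; lia.
case/subseq_cons_split => [sq|[q' -> sq]]; first exact: fin.
rewrite !fmk_cat fmk_cons (fmk_cons (linv a)) fmk_linv mulVKg -fmk_cat => qE sz.
exists (v1 ++ q'); split=> //; first exact: cat_subseq.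
by move: sz; rewrite !size_cat /=; lia.
Qed.

Lemma trivializable_insert u a r k :
  trivializable (u ++ r) k -> trivializable (u ++ a :: linv a :: r) k.
Proof.
case=> v [/subseq_cat_split [v1 [v2 [-> s1 s2]]] vE sz].
exists (v1 ++ a :: linv a :: v2); split.
- by apply: cat_subseq => //; rewrite /= !eqxx.
- by move: vE; rewrite !fmk_cat fmk_cons (fmk_cons (linv a)) fmk_linv mulVKg.
- by move: sz; rewrite !size_cat /=; lia.
Qed.

Lemma trivializable_reduce u w k :
  trivializable (u ++ reduce w) k <-> trivializable (u ++ w) k.
Proof.
elim: w u => // a w IH u; rewrite -[u ++ a :: w]cat_rcons -IH /= -/(reduce w).
case: (reduce w) => [|b r] /=; first by rewrite cats1 cats0.
rewrite cat_rcons; case: ifP => // /eqP ->; split; first last.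
  by rewrite -{2}(linvK b); apply: trivializable_cancel.
by rewrite -{2}(linvK b); apply: trivializable_insert.
Qed.

(** A product of m conjugates of letters, spelled out as a word, becomes trivial
    after deletion of the m middle letters; free reduction carries this over to
    every other word for the same element. *)
Lemma trivializable_norm w : trivializable w (N (fmk w)).
Proof.
have [cs [ccs wE <-]] := conj_norm_seq (fmk w).
have [W WE tW]: exists2 W, fmk W = \prod_(c <- cs) c & trivializable W (size cs).
  elim: cs ccs {wE} => [|c cs IH] ccs.
    by exists [::]; rewrite ?big_nil //; exists [::].
  have [|W WE [v [sv v1 szv]]] := IH; first by move=> d dcs; apply: ccs; rewrite inE dcs orbT.
  have [a [x cE]] := conj_genE (ccs c (mem_head _ _)).
  exists ((winv (fword x) ++ a :: fword x) ++ W).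
    by rewrite big_cons !fmk_cat WE fmk_cons fmk_winv !fwordK cE conjgE.
  exists ((winv (fword x) ++ fword x) ++ v); split.
  - by rewrite !cat_subseq // subseq_cons.
  - by rewrite !fmk_cat fmk_winv v1 mulVg mulg1.
  - by rewrite !size_cat /=; lia.
move/(trivializable_reduce [::]): tW; move: WE; rewrite -wE => /fmk_eq ->.
by move/(trivializable_reduce [::]).
Qed.

Lemma dist_subseq v w : subseq v w -> dist (fmk w) (fmk v) + size v <= size w.
Proof.
elim: w v => [|a w IH] v; first by rewrite subseq0 => /eqP ->; rewrite distxx.
case/subseq_cons_split => [/IH H|[v' -> /IH H]] /=; last first.
  by rewrite fmk_cons (fmk_cons a v') distMl addnS ltnS.
apply: leq_trans (_ : 1 + (dist (fmk w) (fmk v) + size v) <= _); last by rewrite add1n ltnS.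
rewrite addnA leq_add2r; apply: leq_trans (dist_triangle (fmk w) _ _) _.
by rewrite leq_add2r; apply: dist_one_deletion; exists [::], a, w.
Qed.

Lemma conj_norm_one_deletion w k : N (fmk w) = k.+1 ->
  exists2 v, one_deletion w v & N (fmk v) <= k.
Proof.
move=> Nw; have [v [sv v1]] := trivializable_norm w; rewrite Nw => sz.
have [w' dw sv']: exists2 w', one_deletion w w' & subseq v w'.
  have: v != w by apply: contra_eq_neq Nw => <-; rewrite v1 conj_norm1.
  elim: w v sv {Nw v1 sz} => [|a w IH] v.
    by rewrite subseq0 => /eqP ->; rewrite eqxx.
  case/subseq_cons_split => [sv _|[v' -> sv]]; first by exists w => //; exists [::], a, w.
  rewrite eqseq_cons eqxx => /(IH _ sv) [w' [w1 [b [w2 [-> ->]]]] s'].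
  by exists (a :: w1 ++ w2); [exists (a :: w1), b, w2 | rewrite /= eqxx].
exists w' => //; have := dist_subseq sv'; rewrite v1 distC dist1g.
by move: (size_one_deletion dw); lia.
Qed.

End Deletion.

(** * Exponent sums *)
Section ExponentSum.
Local Open Scope group_scope.
Variables (S : choiceType) (f : S -> int).
Implicit Types (g h : freeGroup S) (w : seq (letter S)) (a : letter S).
Import GRing.Theory.

Definition letter_wt a : int := (if a.2 then - f a.1 else f a.1)%R.
Definition word_wt w : int := (\sum_(a <- w) letter_wt a)%R.
Definition expsum g : int := word_wt (fword g).

Lemma word_wt_cat u v : word_wt (u ++ v) = (word_wt u + word_wt v)%R.
Proof. exact: big_cat. Qed.

Lemma word_wt_reduce w : word_wt (reduce w) = word_wt w.
Proof.
elim: w => [//|a w IH]; rewrite [RHS]/word_wt big_cons -/(word_wt w) -IH /= -/(reduce w).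
case: (reduce w) => [|b v] /=; first by rewrite /word_wt big_seq1 big_nil addr0.
case: ifP => [/eqP->|_]; last by rewrite /word_wt !big_cons.
by rewrite /word_wt big_cons /letter_wt /=; case: b.2 => /=; lia.
Qed.

Lemma expsum_fmk w : expsum (fmk w) = word_wt w.
Proof. exact: word_wt_reduce. Qed.

Lemma expsumM g h : expsum (g * h) = (expsum g + expsum h)%R.
Proof. by rewrite -{1}(fwordK g) -{1}(fwordK h) -fmk_cat expsum_fmk word_wt_cat. Qed.

Lemma expsum1 : expsum 1 = 0%R.
Proof. by rewrite /expsum /word_wt big_nil. Qed.

Lemma expsumV g : expsum g^-1 = (- expsum g)%R.
Proof. by have := expsumM g^-1 g; rewrite mulVg expsum1; lia. Qed.

Lemma expsumX g n : expsum (g ^+ n) = (expsum g *+ n)%R.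
Proof. by elim: n => [|n IH]; rewrite ?expsum1 // expgS mulrS expsumM IH. Qed.

Lemma expsumJ g h : expsum (g ^ h) = expsum g.
Proof. by rewrite conjgE !expsumM expsumV; lia. Qed.

Lemma expsum_letter a : expsum (fmk [:: a]) = letter_wt a.
Proof. by rewrite expsum_fmk /word_wt big_seq1. Qed.

Lemma expsum_le_norm g : (forall s, `|f s|%N <= 1) -> `|expsum g|%N <= conj_norm g.
Proof.
move=> f1; have [cs [ccs -> <-]] := conj_norm_seq g.
elim: cs ccs => [|c cs IH] ccs; first by rewrite big_nil expsum1.
rewrite big_cons expsumM /=.
have /IH : {in cs, forall d, conj_gen d} by move=> d dcs; apply: ccs; rewrite inE dcs orbT.
have [a [x ->]] := conj_genE (ccs c (mem_head _ _)).
rewrite expsumJ expsum_letter /letter_wt; move: (f1 a.1).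
by move: (f a.1) (expsum _) (size cs) => t e m; case: a.2; lia.
Qed.
End ExponentSum.

(** * Periodic words *)
Section PeriodicWords.
Local Open Scope group_scope.
Variable S : choiceType.
Implicit Types (x y z g h c : freeGroup S) (u v w P U V A B C T X Y Z : seq (letter S)).
Implicit Types (a b : letter S).

Lemma winv_cat u v : winv (u ++ v) = winv v ++ winv u.
Proof. by rewrite /winv map_cat rev_cat. Qed.

Lemma size_winv u : size (winv u) = size u.
Proof. by rewrite size_rev size_map. Qed.

Lemma reduced_catl u v : reduced (u ++ v) -> reduced u.
Proof. by case: u => // a u; rewrite /reduced /= cat_path => /andP []. Qed.

Lemma reduced_catr u v : reduced (u ++ v) -> reduced v.
Proof.
elim: u => //= a u IH H; apply: IH.
exact: path_sorted H.
Qed.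

Lemma reduced_glue A U B : 0 < size U ->
  reduced (A ++ U) -> reduced (U ++ B) -> reduced (A ++ U ++ B).
Proof.
case: U => // b U _; case: A => // a A.
rewrite /reduced /= !cat_path /= cat_path => /and3P [-> -> ->].
by move=> /andP [_ ->].
Qed.

Lemma reduced_rcons_cons A a b B : reduced (rcons A a ++ b :: B) =
  [&& reduced (rcons A a), a != linv b & reduced (b :: B)].
Proof. by case: A => [|c A]; rewrite /reduced //= cat_path /= last_rcons. Qed.

Lemma cancel_words A B : reduced A -> reduced B ->
  exists A' Z B', [/\ A = A' ++ Z, B = winv Z ++ B' & reduced (A' ++ B')].
Proof.
elim/last_ind: A B => [|A a IH] B rA rB; first by exists [::], [::], B.
case: B rB => [|b B] rB.
  by exists (rcons A a), [::], [::]; rewrite !cats0.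
have [bE|ba] := eqVneq b (linv a); last first.
  exists (rcons A a), [::], (b :: B); split; rewrite ?cats0 // cat_rcons.
  rewrite -cat1s; apply: reduced_glue => //; first by rewrite cats1.
  by rewrite /reduced /=; move: rB; rewrite /reduced /= => ->; rewrite eq_linv ba.
have [||A' [Z [B' [AE BE r]]]] := IH B.
- by move: rA; rewrite -cats1; apply: reduced_catl.
- exact: path_sorted rB.
exists A', (rcons Z a), B'; split=> //; first by rewrite AE rcons_cat.
by rewrite bE BE /winv map_rcons rev_rcons.
Qed.

Definition rep n U := flatten (nseq n U).

Lemma repS n U : rep n.+1 U = U ++ rep n U. Proof. by []. Qed.

Lemma repSr n U : rep n.+1 U = rep n U ++ U.
Proof. by elim: n => [|n IH]; [rewrite /rep /= cats0 | rewrite repS {1}IH catA]. Qed.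

Lemma rep_add m n U : rep (m + n) U = rep m U ++ rep n U.
Proof. by rewrite /rep nseqD flatten_cat. Qed.

Lemma size_rep n U : size (rep n U) = (n * size U)%N.
Proof. by elim: n => // n IH; rewrite repS size_cat IH. Qed.

Lemma fmk_rep n U : fmk (rep n U) = fmk U ^+ n.
Proof. by elim: n => // n IH; rewrite repS fmk_cat IH expgS. Qed.

Lemma winv_rep n U : winv (rep n U) = rep n (winv U).
Proof. by elim: n => // n IH; rewrite repS winv_cat IH -repSr. Qed.

Lemma reduced_rep n U : reduced (U ++ U) -> reduced (rep n U).
Proof.
case: U => [|a U]; first by move=> _; rewrite (@size0nil _ (rep n [::])) // size_rep muln0.
move=> rU; case: n => // n; elim: n => [|n IH].
  by rewrite /rep /= cats0; apply: reduced_catl rU.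
by rewrite repS {1}repS; apply: reduced_glue.
Qed.

Lemma reduced_winv2 U : reduced (U ++ U) -> reduced (winv U ++ winv U).
Proof. by move/winv_reduced; rewrite winv_cat. Qed.

Lemma periodic_prefix n U A T E : rep n U = (A ++ T) ++ E -> size T = size U ->
  U ++ A = A ++ T.
Proof.
case: n => [|n] RE sT.
  have /(congr1 size) := RE; rewrite !size_cat /= => s0.
  rewrite (@size0nil _ A) 1?(@size0nil _ U) 1?(@size0nil _ T) //; move: s0 sT;
    by case: (size T); lia.
have sA : size A <= size (rep n U).
  by move: (congr1 size RE); rewrite repS !size_cat; lia.
have -> : A ++ T = take (size A + size U) (rep n.+1 U).
  by rewrite RE take_size_cat // size_cat sT.
have -> : A = take (size A) (rep n.+1 U) by rewrite RE -catA take_size_cat.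
rewrite repSr takel_cat // -repSr repS take_cat size_take_min; case: ltnP => [|_].
  by lia.
by congr (_ ++ _); congr take; lia.
Qed.

(** Along a periodic word, the last full period read so far is the conjugate of
    [U] by the prefix that has been read. *)
Lemma periodic_prefix_conj n U C T A E : rep n U = C ++ E -> C = A ++ T ->
  size T = size U -> fmk U * fmk C = fmk C * fmk T.
Proof.
by move=> RE CE sT; rewrite CE in RE *; rewrite -!fmk_cat catA (periodic_prefix RE sT).
Qed.


(** A cancellation in U^n1 X V^n2 that leaves less than a period on one side
    uses up [X] and continues for at least one more period, along which a part of
    U^n1 is inverse to a part of V^n2.  By [periodic_prefix_conj] this common
    period is a conjugate both of U and of V^-1, and the conjugator is X up to
    powers of U and V. *)
Lemma long_cancellation U V X R n1 n2 : reduced (U ++ U) -> reduced (V ++ V) ->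
  0 < size U -> size U = size V -> reduced X -> size X <= R ->
  R.*2 + 3 <= n1 -> R.*2 + 3 <= n2 ->
  fmk U * fmk X = fmk X * (fmk V)^-1 \/
  exists2 Y, reduced (U ++ Y ++ V) &
    fmk (U ++ Y ++ V) = fmk U ^+ n1 * fmk X * fmk V ^+ n2.
Proof.
move=> rU rV U0 sUV rX sX n1R n2R.
have [A [Z1 [X2 [AE XE rAX]]]] := cancel_words (reduced_rep n1 rU) rX.
have [C [Z [B [CE BE rCB]]]] := cancel_words rAX (reduced_rep n2 rV).
have sA := congr1 size AE; have sXE := congr1 size XE.
have sC := congr1 size CE; have sB := congr1 size BE.
move: sA sXE sC sB; rewrite !size_cat !size_rep !size_winv -sUV => sA sXE sC sB.
have aE : fmk U ^+ n1 = fmk A * fmk Z1 by rewrite -fmk_rep AE fmk_cat.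
have xE : fmk X = (fmk Z1)^-1 * fmk X2 by rewrite XE fmk_cat fmk_winv.
have cE : fmk A * fmk X2 = fmk C * fmk Z by rewrite -!fmk_cat CE.
have bE : fmk V ^+ n2 = (fmk Z)^-1 * fmk B by rewrite -fmk_rep BE fmk_cat fmk_winv.
have gE : fmk U ^+ n1 * fmk X * fmk V ^+ n2 = fmk (C ++ B).
  by rewrite aE xE bE fmk_cat !mulgA mulgK cE mulgK.
have n1p : ((R.*2 + 3) * size U <= n1 * size U)%N by rewrite leq_mul2r n1R orbT.
have n2p : ((R.*2 + 3) * size U <= n2 * size U)%N by rewrite leq_mul2r n2R orbT.
have Rp : (R <= R * size U)%N by rewrite leq_pmulr.
have n1pE : ((R.*2 + 3) * size U = R * size U + R * size U + 3 * size U)%N by lia.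
(* The cancellation leaves a full period on both sides. *)
have [/andP [sC' sB']|] := boolP ((size U <= size C) && (size U <= size B)).
  right.
  have UC : C = U ++ drop (size U) C.
    rewrite -{1}(cat_take_drop (size U) C); congr (_ ++ _).
    have := congr1 (take (size U)) CE; rewrite !takel_cat //; last by lia.
    move <-; have := congr1 (take (size U)) AE; rewrite takel_cat; last by lia.
    by case: (n1) n1R => [|m _]; [lia | rewrite repS take_size_cat].
  have [B' BV] : exists B', B = B' ++ V.
    exists (drop (size Z) (rep n2.-1 V)).
    have := congr1 (drop (size Z)) BE; rewrite -{2}(size_winv Z) drop_size_cat // => <-.
    case: (n2) n2R sB => [|m _ sB] /=; first by lia.
    rewrite mulSn in sB.
    rewrite repSr drop_cat size_rep -sUV; case: ltnP => // ge.
    have -> : size Z = (m * size U)%N by lia.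
    by rewrite subnn drop0 drop_oversize // size_rep sUV.
  exists (drop (size U) C ++ B').
    by move: rCB; rewrite {1}UC BV -!catA.
  by rewrite gE [in RHS]UC [in RHS]BV -!catA.
move=> short; left.
have sZ : R + size U <= size Z by lia.
have [Z3 AC ZE] : exists2 Z3, A = C ++ Z3 & Z = Z3 ++ X2.
  exists (drop (size C) A); have sCA : size C <= size A by lia.
    have := congr1 (take (size C)) CE; rewrite takel_cat // (take_size_cat Z (erefl _)) => CA.
    by rewrite -{1}CA cat_take_drop.
  have := congr1 (drop (size C)) CE; rewrite (drop_size_cat Z (erefl (size C))) drop_cat => <-.
  case: ltnP => // sAC; have -> : size C = size A by lia.
  by rewrite drop_size subnn drop0.
have sZ3 : size U <= size Z3 by move: (congr1 size ZE); rewrite size_cat; lia.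
have [Z4 [T [Z3E sT]]] : exists Z4 T, Z3 = Z4 ++ T /\ size T = size U.
  exists (take (size Z3 - size U) Z3), (drop (size Z3 - size U) Z3).
  by rewrite cat_take_drop size_drop; split=> //; lia.
(* [T] is a full period next to [X] that cancels, read from the two sides. *)
have AE2 : A = (C ++ Z4) ++ T by rewrite AC Z3E catA.
have uT := periodic_prefix_conj AE AE2 sT.
have BE2 : rep n2 (winv V) = ((winv B ++ Z4) ++ T) ++ X2.
  by rewrite -winv_rep BE winv_cat winvK ZE Z3E -!catA.
have vT := periodic_prefix_conj BE2 (erefl _) (etrans sT (etrans sUV (esym (size_winv V)))).
have := congr1 (@fmk S) BE2; rewrite fmk_rep fmk_cat.
move: (fmk (_ ++ T)) (fmk T) vT uT => c2 t vT uT c2E.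
have {}vT : (fmk V)^-1 * (fmk X2)^-1 = (fmk X2)^-1 * t.
  have c2E' : c2 = (fmk (winv V)) ^+ n2 * (fmk X2)^-1 by rewrite c2E mulgK.
  move: vT; rewrite c2E' mulgA -expgS expgSr -!mulgA => /mulgI.
  by rewrite fmk_winv.
have AX : fmk A = fmk U ^+ n1 * (fmk X * (fmk X2)^-1).
  by rewrite aE xE !mulgK.
move: uT; rewrite AX mulgA -expgS expgSr -!mulgA => /mulgI.
by rewrite -vT !mulgA => /mulIg.
Qed.

(** The Euclidean algorithm on the lengths of the two words. *)
Lemma commuting_words (u v : seq (letter S)) : u ++ v = v ++ u ->
  exists w i j, u = rep i w /\ v = rep j w.
Proof.
have [n] := ubnP (size u + size v); elim: n u v => // n IH u v.
wlog uv : u v / size u <= size v => [hw lt E|].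
  have [le|/ltnW le] := leqP (size u) (size v); first exact: hw.
  by have [||w [i [j [? ?]]]] := hw v u le; rewrite 1?addnC //; exists w, j, i.
case: (posnP (size u)) => [/size0nil -> _ _|u0 lt E].
  by exists v, 0%N, 1%N; rewrite /rep /= cats0.
have vE : v = u ++ drop (size u) v.
  have := congr1 (take (size u)) E; rewrite take_size_cat // takel_cat // => {1}->.
  by rewrite cat_take_drop.
have [||w [i [j [uE dE]]]] := IH u (drop (size u) v).
- by rewrite size_drop; lia.
- move: E; rewrite {1 2}vE -catA => /(congr1 (drop (size u))).
  by rewrite !drop_size_cat // => <-.
by exists w, i, (i + j); split=> //; rewrite vE {1}uE dE rep_add.
Qed.

Lemma word_wt_rep (f : S -> int) n U : word_wt f (rep n U) = (word_wt f U *+ n)%R.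
Proof.
elim: n => [|n IH]; first by rewrite /word_wt big_nil.
by rewrite repS word_wt_cat IH GRing.mulrS.
Qed.

(** Without cancellation, commutation in the group is commutation of words, so
    [P] and [y] are powers of one word; its exponent sum divides that of [P]. *)
Lemma centralizer_pos f P y : reduced (P ++ P) -> `|word_wt f P|%N = 1%N ->
  reduced (fword y ++ P) -> fmk P * y = y * fmk P -> exists j, y = fmk P ^+ j.
Proof.
move=> rP fP ryP com.
have [A [Z [B [PE YE rAB]]]] := cancel_words (reduced_catl rP) (fword_reduced y).
have AB : A ++ B = fword y ++ P.
  apply: fmk_inj => //; rewrite !fmk_cat fwordK -com -(fwordK y) PE YE !fmk_cat fmk_winv.
  by rewrite mulgA mulgK.
have Z0 : Z = [::].
  apply: size0nil; move: (congr1 size AB) (congr1 size PE) (congr1 size YE).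
  by rewrite !size_cat size_winv; lia.
have E : P ++ fword y = fword y ++ P by rewrite -AB {1}PE YE Z0 cats0.
have [w [i [j [Pw yw]]]] := commuting_words E.
have i1 : i = 1%N.
  by move/eqP: fP; rewrite Pw word_wt_rep -GRing.mulr_natr abszM natz muln_eq1 => /andP [_ /eqP].
by exists j; rewrite -fmk_rep Pw i1 [rep 1 w]cats0 -yw fwordK.
Qed.

(** Since [P] is cyclically reduced, [y] cannot cancel against both [P] and its
    inverse. *)
Lemma centralizer f P y : reduced (P ++ P) -> `|word_wt f P|%N = 1%N ->
  fmk P * y = y * fmk P ->
  exists (b : bool) j, y = (if b then (fmk P)^-1 else fmk P) ^+ j.
Proof.
move=> rP fP com; have [ryP|nryP] := boolP (reduced (fword y ++ P)).
  by have [j ->] := centralizer_pos rP fP ryP com; exists false, j.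
have ryV : reduced (fword y ++ winv P).
  case: (lastP (fword y)) nryP (fword_reduced y) => [|Y a] nr rY.
    by rewrite cat0s; apply: winv_reduced; apply: reduced_catl rP.
  case: (lastP P) rP nr {fP com} => [|Q d]; first by move=> _; rewrite cats0 rY.
  case PE : (rcons Q d) => [|c P']; first by case: (Q) PE.
  rewrite -{1}PE => rP nr.
  have rcP : reduced (c :: P') by apply: reduced_catr rP.
  move: rP nr; rewrite !reduced_rcons_cons rY rcP !andbT /= => /andP [_ dc] /negbNE/eqP ac.
  rewrite /winv -PE map_rcons rev_rcons reduced_rcons_cons rY -rev_rcons -map_rcons PE.
  by rewrite winv_reduced // linvK andbT ac eq_sym.
have fV : `|word_wt f (winv P)|%N = 1%N.
  by rewrite -expsum_fmk fmk_winv expsumV expsum_fmk; lia.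
have [|j yE] := centralizer_pos (reduced_winv2 rP) fV ryV.
  rewrite fmk_winv; apply: (mulgI (fmk P)); rewrite mulVKg mulgA com mulgK //.
by exists true, j; rewrite -fmk_winv.
Qed.

Lemma cyclic_reduction g : g <> 1 ->
  exists x P, [/\ 0 < size P, reduced (P ++ P) & g = fmk P ^ x].
Proof.
rewrite -(fwordK g); move: (fword g) (fword_reduced g) => w.
have [n] := ubnP (size w); elim: n w => // n IH [|c w] lt rw w1 //.
case: (lastP w) rw lt w1 => [|u d] rw lt w1.
  exists 1, [:: c]; split; rewrite ?conjg1 // /reduced /= andbT.
  by apply/eqP => /(congr1 snd) /=; case: (c.2).
have [dc|dc] := eqVneq d (linv c); last first.
  exists 1, (c :: rcons u d); split; rewrite ?conjg1 //.
  by rewrite -{1}rcons_cons reduced_rcons_cons rcons_cons rw dc.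
have E : fmk (c :: rcons u d) = fmk u ^ fmk [:: linv c].
  by rewrite conjgE -cats1 fmk_cons fmk_cat dc fmk_linv invgK.
have [|||x [P [P0 rP uE]]] := IH u.
- by move: lt; rewrite /= size_rcons; lia.
- by move: rw; rewrite -cats1 => /path_sorted/reduced_catl.
- by move=> u1; apply: w1; rewrite E u1 conj1g.
by exists (x * fmk [:: linv c]), P; rewrite E uE conjgM.
Qed.
End PeriodicWords.

(** * Products of large powers with short entries *)
Section Blocks.
Local Open Scope group_scope.
Variables (S : choiceType) (f : S -> int) (P : seq (letter S)).
Hypothesis f_le1 : forall s, `|f s|%N <= 1.
Hypothesis P_cyclic : reduced (P ++ P).
Hypothesis fP : `|word_wt f P|%N = 1%N.
Local Notation F := (freeGroup S).
Local Notation N := (@conj_norm S).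
Definition len (x : freeGroup S) := size (fword x).
Implicit Types (x y z g h c : F) (b : bool) (n i j k : nat).

Definition signed_word b := if b then winv P else P.
Definition signed b : F := if b then (fmk P)^-1 else fmk P.

(** The block (b, n, x) stands for the n-th power of P, or of its inverse if b
    holds, followed by the entry x. *)
Definition block : Type := bool * nat * F.
Implicit Types (e : block) (s t : seq block).

Definition block_prod s : F := foldr (fun e g => signed e.1.1 ^+ e.1.2 * e.2 * g) 1 s.
Local Notation val := block_prod.

Lemma val_cat s t : val (s ++ t) = val s * val t.
Proof. by elim: s => [|e s IH] /=; rewrite ?mul1g // IH mulgA. Qed.

Lemma P_gt0 : 0 < size P.
Proof. by move: fP; case: P => //; rewrite /word_wt big_nil. Qed.

Lemma fmk_signed_word b : fmk (signed_word b) = signed b.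
Proof. by case: b; rewrite //= fmk_winv. Qed.

Lemma size_signed_word b : size (signed_word b) = size P.
Proof. by case: b; rewrite //= size_winv. Qed.

Lemma signed_word_cyclic b : reduced (signed_word b ++ signed_word b).
Proof. by case: b; rewrite //=; apply: reduced_winv2. Qed.

Lemma expsum_signed b : expsum f (signed b) = (if b then - word_wt f P else word_wt f P)%R.
Proof. by case: b; rewrite /signed ?expsumV expsum_fmk. Qed.

Lemma len_fmk w : len (fmk w) <= size w.
Proof. exact: size_reduce. Qed.

Lemma lenM x y : len (x * y) <= len x + len y.
Proof. by rewrite -size_cat; apply: size_reduce. Qed.

Lemma lenV x : len x^-1 = len x.
Proof.
have le y : len y^-1 <= len y.
  by rewrite -{1}(fwordK y) -fmk_winv; apply: leq_trans (len_fmk _) _; rewrite size_winv.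
by apply/eqP; rewrite eqn_leq le -{1}(invgK x) le.
Qed.

Lemma len_reduced w : reduced w -> len (fmk w) = size w.
Proof. by move=> rw; rewrite /len /= reduce_id. Qed.

Lemma len_signedX b n : len (signed b ^+ n) <= n * size P.
Proof.
rewrite -fmk_signed_word -fmk_rep; apply: leq_trans (len_fmk _) _.
by rewrite size_rep size_signed_word.
Qed.

(** If [b] and [b'] agree, the relation says that [x] inverts [P], which is
    excluded by the exponent sum. *)
Lemma signed_opposite b b' x : signed b * x = x * (signed b')^-1 -> commute (fmk P) x.
Proof.
case: b; case: b' => /= H.
- have := congr1 (expsum f) H; rewrite invgK !expsumM expsumV expsum_fmk.
  by move: fP; move: (word_wt f P) (expsum f x) => u v; lia.
- apply: (mulgI (fmk P)^-1); rewrite mulKg mulgA H mulgVK //.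
- by rewrite invgK in H.
- have := congr1 (expsum f) H; rewrite !expsumM expsumV expsum_fmk.
  by move: fP; move: (word_wt f P) (expsum f x) => u v; lia.
Qed.

(** The first and the last entry are left out because they lie next to a single
    power of P. *)
Definition interior_commutes s := exists i,
  [/\ 0 < i, i.+1 < size s & commute (fmk P) (nth 1 [seq e.2 | e <- s] i)].

(** The first exponent is 0, so that the product starts with an entry. *)
Definition admissible m R s :=
  [&& (if s is e :: _ :: _ then e.1.2 == 0%N else false),
      all (fun e => len e.2 <= R) s & all (fun e => m <= e.1.2) (behead s)].

(** As long as no entry commutes with [P], [long_cancellation] shows that the
    reduced word of the product read so far grows and ends with a full period,
    which keeps the next power of [P] from being cancelled. *)
Lemma long_block_prod R g Y b k x s :
  reduced (Y ++ signed_word b) -> g = fmk (Y ++ signed_word b) ->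
  R.*2.+1 <= size (Y ++ signed_word b) ->
  R.*2 + 3 <= k -> len x <= R ->
  all (fun e => len e.2 <= R) s -> all (fun e => 4 * R + 6 <= e.1.2) s ->
  (exists i, i < (size s) /\ commute (fmk P) (nth 1 (x :: [seq e.2 | e <- s]) i)) \/
  R < len (g * signed b ^+ k * x * val s).
Proof.
elim: s g Y b k x => [|[[b' n'] x'] s IH] g Y b k x rY -> sY kR xR /=.
  move=> _ _; right; rewrite mulg1 -fmk_signed_word -fmk_rep -fmk_cat.
  have r : reduced ((Y ++ signed_word b) ++ rep k (signed_word b)).
    rewrite -catA; apply: reduced_glue; rewrite ?size_signed_word ?P_gt0 //.
    by rewrite -repS; apply: reduced_rep (signed_word_cyclic b).
  have := lenM (fmk ((Y ++ signed_word b) ++ rep k (signed_word b)) * x) x^-1.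
  rewrite mulgK len_reduced // lenV size_cat; lia.
case/andP => x'R sR /andP [n'R sn].
have xR' : size (fword x) <= R by [].
(* An exponent of at least 4R + 6 provides 2R + 3 periods for the entry before the
   power and as many for the entry after it. *)
have := @long_cancellation _ (signed_word b) (signed_word b') (fword x) R k (R.*2 + 3)
  (signed_word_cyclic b) (signed_word_cyclic b').
rewrite !size_signed_word P_gt0 fwordK !fmk_signed_word.
move=> /(_ isT erefl (fword_reduced x) xR kR (leqnn _)).
case=> [/signed_opposite com|[Y' rY' Y'E]]; first by left; exists 0%N.
have rY2 : reduced ((Y ++ signed_word b ++ signed_word b ++ Y') ++ signed_word b').
  rewrite -!catA; apply: reduced_glue; rewrite ?size_signed_word ?P_gt0 //.
  by apply: reduced_glue; rewrite ?size_signed_word ?P_gt0 ?signed_word_cyclic.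
have gE : fmk ((Y ++ signed_word b ++ signed_word b ++ Y') ++ signed_word b') =
    fmk (Y ++ signed_word b) * (signed b ^+ k * x * signed b' ^+ (R.*2 + 3)).
  by rewrite -Y'E -fmk_cat -!catA.
have [||[i [iS com]]|H] := IH _ _ b' (n' - (R.*2 + 3)) x' rY2 (erefl _) _ _ x'R sR sn.
- by move: sY; rewrite !size_cat; lia.
- by lia.
- by left; exists i.+1.
right; move: H; rewrite gE; congr (_ < len _); rewrite -!mulgA; do 3!congr (_ * _).
by rewrite !mulgA -expgnDr subnKC //; lia.
Qed.

(** Baumslag's lemma: otherwise everything after the first entry would have
    length greater than [R], while it is the inverse of that entry. *)
Lemma trivial_block_prod R s :
  admissible (4 * R + 6) R s -> val s = 1 -> interior_commutes s.
Proof.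
case: s => [|[[b0 n0] x0] [|[[b n] x] s]] //=.
move=> /and3P [/eqP /= n00 /and3P [x0R xR sR] /andP [nR sn]].
rewrite n00 expg0 mul1g => v1.
have rq : reduced (rep R.*2 (signed_word b) ++ signed_word b).
  by rewrite -repSr; apply: reduced_rep (signed_word_cyclic b).
have gq : signed b ^+ R.*2.+1 = fmk (rep R.*2 (signed_word b) ++ signed_word b).
  by rewrite -repSr fmk_rep fmk_signed_word.
have [||[i [iS com]]|] := long_block_prod rq gq (k := n - R.*2.+1) _ _ xR sR sn.
- by rewrite -repSr size_rep size_signed_word leq_pmulr // P_gt0.
- by lia.
- by exists i.+1.
rewrite -expgnDr subnKC; last by lia.
rewrite ltnNge => /negP []; move: v1 => /mulg1_eq <-.
by rewrite lenV.
Qed.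

Definition frame s := [seq e.1 | e <- s].

Fixpoint sdist s t : nat :=
  match s, t with e :: s', e' :: t' => dist e.2 e'.2 + sdist s' t' | _, _ => 0 end.

Lemma sdist_cat s1 t1 s2 t2 : frame s1 = frame t1 ->
  sdist (s1 ++ s2) (t1 ++ t2) = sdist s1 t1 + sdist s2 t2.
Proof.
elim: s1 t1 => [|e s1 IH] [|e' t1] //= [_ E].
by rewrite IH // addnA.
Qed.

Lemma sdist_cons a x s a' y t : sdist ((a, x) :: s) ((a', y) :: t) = dist x y + sdist s t.
Proof. by []. Qed.

Lemma sdistxx s : sdist s s = 0%N.
Proof. by elim: s => //= e s ->; rewrite distxx. Qed.

Lemma sdist_triangle s t u : frame s = frame t -> frame t = frame u ->
  sdist s u <= sdist s t + sdist t u.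
Proof.
elim: s t u => [|e s IH] [|e' t] [|e'' u] //= [_ E1] [_ E2].
have := IH _ _ E1 E2; have := dist_triangle e'.2 e.2 e''.2; lia.
Qed.

Lemma dist_block_prod s t : frame s = frame t -> dist (val s) (val t) <= sdist s t.
Proof.
elim: s t => [|e s IH] [|e' t] //=; first by rewrite distxx.
case=> e1 E; rewrite e1; apply: leq_trans (distM _ _ _ _) _.
by rewrite distMl leq_add2l IH.
Qed.

Lemma frame_split t s1 e s2 : frame t = frame (s1 ++ e :: s2) ->
  exists t1 z t2, [/\ t = t1 ++ (e.1, z) :: t2, frame s1 = frame t1 & frame s2 = frame t2].
Proof.
elim: s1 t => [|e1 s1 IH] [|[e' z] t] //= [-> E]; first by exists [::], z, t.
have [t1 [z' [t2 [-> E1 E2]]]] := IH _ E.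
by exists ((e1.1, z) :: t1), z', t2; rewrite /= E1.
Qed.

Lemma one_deletion_rep n (U v : seq (letter S)) : one_deletion (rep n U) v -> exists i j w,
  [/\ n = i + j.+1, one_deletion U w & v = rep i U ++ w ++ rep j U].
Proof.
elim: n v => [|n IH] v.
  by case=> -[|? ?] [? [? []]].
rewrite repS => /one_deletion_cat [[w dw ->]|[v' /IH [i [j [w [-> dw ->]]]] ->]].
  by exists 0%N, n, w.
by exists i.+1, j, w; rewrite repS -catA.
Qed.

Definition block_word s := flatten [seq rep e.1.2 (signed_word e.1.1) ++ fword e.2 | e <- s].

Lemma fmk_block_word s : fmk (block_word s) = val s.
Proof.
elim: s => //= e s IH.
by rewrite /block_word /= !fmk_cat fmk_rep fmk_signed_word fwordK IH.
Qed.

Lemma dist_one_deletion_fword (u v : seq (letter S)) x y :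
  one_deletion u v -> fmk u = x -> fmk v = y -> dist x y <= 1.
Proof. by move=> d <- <-; apply: dist_one_deletion. Qed.

Lemma one_deletion_block_word s v : one_deletion (block_word s) v ->
  (exists s1 a x s2 x', [/\ s = s1 ++ (a, x) :: s2, len x' <= len x, dist x x' <= 1
      & fmk v = val (s1 ++ (a, x') :: s2)]) \/
  (exists s1 b i j c x s2, [/\ s = s1 ++ (b, i + j.+1, x) :: s2, len c <= size P,
      dist (signed b) c <= 1
      & fmk v = val s1 * (signed b ^+ i * c * signed b ^+ j * x) * val s2]).
Proof.
elim: s v => [|[[b n] x] s IH] v /=; first by case=> -[|? ?] [? [? []]].
rewrite [block_word _]/= => /one_deletion_cat [[w /one_deletion_cat dw ->]|[w /IH dw ->]].
  case: dw => [[u /one_deletion_rep [i [j [c [nE dc ->]]]] ->]|[u du ->]]; last first.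
    left; exists [::], (b, n), x, s, (fmk u); split=> //.
    - by apply: leq_trans (len_fmk _) _; rewrite /len (size_one_deletion du).
    - by apply: (dist_one_deletion_fword du); rewrite ?fwordK.
    - by rewrite !fmk_cat fmk_rep fmk_signed_word fmk_block_word.
  right; exists [::], b, i, j, (fmk c), x, s; split=> /=.
  - by move: nE => /= ->.
  - by apply: leq_trans (len_fmk _) _; rewrite -(size_signed_word b) (size_one_deletion dc).
  - by apply: (dist_one_deletion_fword dc); rewrite ?fmk_signed_word.
  - by rewrite !fmk_cat !fmk_rep fmk_signed_word fwordK fmk_block_word mul1g !mulgA.
rewrite !fmk_cat fmk_rep fmk_signed_word fwordK.
case: dw => [[s1 [a [y [s2 [y' [-> ly dy ->]]]]]]|[s1 [b' [i [j [c [y [s2 [-> lc dc ->]]]]]]]]].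
  by left; exists ((b, n, x) :: s1), a, y, s2, y'.
by right; exists ((b, n, x) :: s1), b', i, j, c, y, s2; rewrite /= !mulgA.
Qed.

Implicit Types (m R K : nat).

(** Passing from the entries of [s] to those of [t] is part of an optimal way of
    making [block_prod s] trivial, and it makes an interior entry commute with P. *)
Definition clustered s := exists t,
  [/\ frame s = frame t, interior_commutes t & sdist s t + N (val t) <= N (val s)].

Lemma size_frame s t : frame s = frame t -> size s = size t.
Proof. by move/(congr1 size); rewrite !size_map. Qed.

Lemma frame_cat s t : frame (s ++ t) = frame s ++ frame t.
Proof. exact: map_cat. Qed.

Lemma clustered_step s s' : frame s = frame s' ->
  sdist s s' + N (val s') <= N (val s) -> clustered s' -> clustered s.
Proof.
move=> E le [t [E' int le']]; exists t; split=> //; first by rewrite E.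
have := sdist_triangle E E'; lia.
Qed.

Lemma interior_update s1 s2 a a' y y' : (commute (fmk P) y -> commute (fmk P) y') ->
  interior_commutes (s1 ++ (a, y) :: s2) -> interior_commutes (s1 ++ (a', y') :: s2).
Proof.
move=> imp [i [i0 iS com]]; exists i; split=> //.
  by move: iS; rewrite !size_cat.
move: com; rewrite !map_cat /= !nth_cat; case: ltnP => // _.
by case: (i - _)%N.
Qed.

Lemma interior_remove s1 a y e s2 : 0 < size s1 ->
  interior_commutes (s1 ++ (a, y) :: e :: s2) ->
  commute (fmk P) y \/ interior_commutes (s1 ++ e :: s2).
Proof.
move=> s1_gt0 [i [i0 iS com]].
have [lt|gt|eq] := ltngtP i (size s1).
- right; exists i; split=> //; first by move: iS; rewrite !size_cat /=; lia.
  by move: com; rewrite !map_cat !nth_cat size_map lt.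
- case: i {i0} iS gt com => // i iS gt com; right; exists i.
  split; [lia | by move: iS; rewrite !size_cat /=; lia |].
  move: com; rewrite !map_cat !nth_cat size_map.
  case: ltnP => [|_]; first by lia.
  case: ltnP => [|_]; first by lia.
  by rewrite subSn //; lia.
- by left; move: com; rewrite map_cat nth_cat size_map eq ltnn subnn.
Qed.

Lemma commute_signed b : commute (fmk P) (signed b).
Proof. by case: b; rewrite /signed; [apply: commuteV | ]; apply: commute_refl. Qed.

(** A deletion in the power that follows the entry x0, close to x0: the deleted
    period and the periods before it are added to x0.  At the end the periods are
    returned, which costs 1 because of the missing letter. *)
Lemma clustered_absorb_left s0 a x0 b i j c x s2 : dist (signed b) c <= 1 ->
  let s := s0 ++ (a, x0) :: (b, i + j.+1, x) :: s2 in
  let s' := s0 ++ (a, x0 * signed b ^+ i * c) :: (b, j, x) :: s2 in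
  N (val s') < N (val s) -> clustered s' -> clustered s.
Proof.
move=> dc s s' lt [t [E int le]].
have [t1 [y [t2' [tE E1 E2]]]] := frame_split (esym E).
case: t2' E2 tE => [|[a' z] t2] //= [<- E2] tE; subst t.
have E3 : frame ((b, j, x) :: s2) = frame ((b, j, z) :: t2) by rewrite /= E2.
have dE : dist x0 (y * (signed b ^+ i.+1)^-1) <= dist (x0 * signed b ^+ i * c) y + 1.
  rewrite -(distMr (signed b ^+ i.+1)) mulgVK.
  apply: leq_trans (dist_triangle (x0 * signed b ^+ i * c) _ _) _.
  by rewrite addnC leq_add2l expgSr mulgA distMl.
exists (t1 ++ (a, y * (signed b ^+ i.+1)^-1) :: (b, i + j.+1, z) :: t2); split.
- by rewrite !frame_cat /= E1 E2.
- have := @interior_update (rcons t1 (a, y * (signed b ^+ i.+1)^-1)) t2 (b, j) (b, i + j.+1) z z id.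
  rewrite !cat_rcons; apply; apply: interior_update int => com.
  by apply: commuteM => //; apply/commuteV/commuteX/commute_signed.
- move: le lt; rewrite /s' /s !sdist_cat // !sdist_cons.
  have -> : val (t1 ++ (a, y * (signed b ^+ i.+1)^-1) :: (b, i + j.+1, z) :: t2) =
      val (t1 ++ (a, y) :: (b, j, z) :: t2).
    by rewrite !val_cat /= addnS -addSn expgnDr -!mulgA mulKg.
  move: dE; norm_lia.
Qed.

Lemma clustered_absorb_right s1 b i j c x s2 : dist (signed b) c <= 1 ->
  let s := s1 ++ (b, i + j.+1, x) :: s2 in
  let s' := s1 ++ (b, i, c * signed b ^+ j * x) :: s2 in
  N (val s') < N (val s) -> clustered s' -> clustered s.
Proof.
move=> dc s s' lt [t [E int le]].
have [t1 [y [t2 [tE E1 E2]]]] := frame_split (esym E); subst t.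
have dE : dist x ((signed b ^+ j.+1)^-1 * y) <= dist (c * signed b ^+ j * x) y + 1.
  rewrite -(distMl (signed b ^+ j.+1)) mulVKg.
  apply: leq_trans (dist_triangle (c * signed b ^+ j * x) _ _) _.
  by rewrite addnC leq_add2l expgS !distMr.
exists (t1 ++ (b, i + j.+1, (signed b ^+ j.+1)^-1 * y) :: t2); split.
- by rewrite !frame_cat /= E1 E2.
- apply: interior_update int => com.
  by apply: commuteM => //; apply/commuteV/commuteX/commute_signed.
- move: le lt; rewrite /s' /s !sdist_cat // !sdist_cons.
  have -> : val (t1 ++ (b, i + j.+1, (signed b ^+ j.+1)^-1 * y) :: t2) =
      val (t1 ++ (b, i, y) :: t2).
    by rewrite !val_cat /= expgnDr -!mulgA mulVKg.
  norm_lia.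
Qed.

Lemma commute_signedX y b : commute (fmk P) y ->
  exists l, y = signed b ^+ l \/ y = (signed b ^+ l)^-1.
Proof.
move=> com; have [b' [l ->]] := centralizer P_cyclic fP com.
exists l; rewrite -!expVgn; case: b; case: b' => /=; rewrite /signed ?invgK; by [left|right].
Qed.

Lemma le_dist_signedXV b l : l <= dist (signed b ^+ l)^-1 (signed b).
Proof.
have := @expsum_le_norm _ f ((signed b ^+ l)^-1^-1 * signed b) f_le1.
rewrite /dist invgK expsumM expsumX expsum_signed -GRing.mulr_natr natz.
case: b fP; move: (word_wt f P) (N _) => w m; case: (w) => [[|[|?]]|[|?]] //= _; lia.
Qed.

(** A deletion far from both neighbouring entries: the damaged period c becomes
    an entry.  If the commuting entry found for the new product is the one
    replacing c, it is a power of P, so it only changes the exponent of the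
    surrounding power, and the induction hypothesis is applied once more to the
    original entries with this exponent. *)
Lemma clustered_split s1 b i j c x s2 K : dist (signed b) c <= 1 -> 0 < size s1 ->
  let s := s1 ++ (b, i + j.+1, x) :: s2 in
  let s' := s1 ++ (b, i, c) :: (b, j, x) :: s2 in
  N (val s') <= K -> N (val s) = K.+1 -> K + 2 <= i ->
  (forall n, i + j <= n + K.+1 -> 
     N (val (s1 ++ (b, n, x) :: s2)) <= K -> clustered (s1 ++ (b, n, x) :: s2)) ->
  clustered s' -> clustered s.
Proof.
move=> dc s1_gt0 s s' leK NK iK IH [t [E int le]].
have [t1 [y [t2' [tE E1 E2]]]] := frame_split (esym E).
case: t2' E2 tE => [|[a' z] t2] //= [<- E2] tE; subst t.
have dy : dist y (signed b) <= dist c y + 1.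
  rewrite (distC c); apply: leq_trans (dist_triangle c _ _) _.
  by rewrite leq_add2l distC.
have frameE (n : nat) u1 v u2 : frame s1 = frame u1 -> frame s2 = frame u2 ->
    frame (s1 ++ (b, n, x) :: s2) = frame (u1 ++ (b, n, v) :: u2).
  by move=> F1 F2; rewrite !frame_cat /= F1 F2.
have le' : dist c y + sdist (s1 ++ (b, i + j.+1, x) :: s2) (t1 ++ (b, i + j.+1, z) :: t2) +
    N (val (t1 ++ (b, i, y) :: (b, j, z) :: t2)) <= K.
  by move: le; rewrite /s' !sdist_cat // !sdist_cons; norm_lia.
have t1_gt0 : 0 < size t1 by rewrite -(size_frame E1).
have [comy|int'] := interior_remove t1_gt0 int; last first.
  exists (t1 ++ (b, i + j.+1, z) :: t2); split; first exact: frameE.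
    by have := @interior_update t1 t2 (b, j) (b, i + j.+1) z z id; apply.
  have dv : dist (val (t1 ++ (b, i, y) :: (b, j, z) :: t2)) (val (t1 ++ (b, i + j.+1, z) :: t2))
      <= dist y (signed b).
    by rewrite !val_cat /= expgnDr expgS !mulgA !distMr distMl.
  have := conj_norm_dist (val (t1 ++ (b, i, y) :: (b, j, z) :: t2))
     (val (t1 ++ (b, i + j.+1, z) :: t2)); rewrite /s NK; norm_lia.
(* The entry [y] is a power of [P], hence merges with the powers around it. *)
have [n [nE nK]] : exists n,
    signed b ^+ i * y * signed b ^+ j = signed b ^+ n /\ i + j <= n + K.+1.
  have [l [yE|yE]] := commute_signedX b comy.
    by exists (i + l + j)%N; rewrite yE -!expgnDr; split=> //; lia.
  have li : l <= i by have := le_dist_signedXV b l; rewrite -yE; norm_lia.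
  exists (i - l + j)%N; rewrite yE -expgnFr // -expgnDr; split=> //.
  by have := le_dist_signedXV b l; rewrite -yE; norm_lia.
have valE : val (t1 ++ (b, i, y) :: (b, j, z) :: t2) = val (t1 ++ (b, n, z) :: t2).
  by rewrite !val_cat /= -nE !mulgA.
have sdE m m' u1 v u2 : frame s1 = frame u1 ->
    sdist (s1 ++ (b, m, x) :: s2) (u1 ++ (b, m', v) :: u2) = 
    sdist s1 u1 + (dist x v + sdist s2 u2) by move=> F1; rewrite sdist_cat // sdist_cons.
have Nle : N (val (s1 ++ (b, n, x) :: s2)) + dist c y <= K.
  have := dist_block_prod (frameE n t1 z t2 E1 E2); rewrite distC => dl.
  have := conj_norm_dist (val (t1 ++ (b, n, z) :: t2)) (val (s1 ++ (b, n, x) :: s2)).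
  by move: le' dl; rewrite valE !sdE //; norm_lia.
have [|t [F int2 le2]] := IH n nK; first by lia.
have [u1 [v [u2 [tE F1 F2]]]] := frame_split (esym F); subst t.
exists (u1 ++ (b, i + j.+1, v) :: u2); split; first exact: frameE.
  exact: interior_update int2.
have dv : dist (val (u1 ++ (b, n, v) :: u2)) (val (u1 ++ (b, i + j.+1, v) :: u2))
    <= dist y (signed b).
  by rewrite !val_cat /= -nE expgnDr expgS !mulgA !distMr distMl.
have := conj_norm_dist (val (u1 ++ (b, n, v) :: u2)) (val (u1 ++ (b, i + j.+1, v) :: u2)).
move: le2; rewrite /s NK !sdE //; norm_lia.
Qed.

Lemma admissible_cat m R s1 s2 : 0 < size s1 -> 0 < size s2 ->
  admissible m R (s1 ++ s2) = [&& (if s1 is e :: _ then e.1.2 == 0%N else false),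
    all (fun e => len e.2 <= R) s1, all (fun e => m <= e.1.2) (behead s1),
    all (fun e => len e.2 <= R) s2 & all (fun e => m <= e.1.2) s2].
Proof.
case: s1 => // e s1 _ s2_gt0.
have -> : admissible m R ((e :: s1) ++ s2) = [&& e.1.2 == 0%N,
    all (fun e => len e.2 <= R) ((e :: s1) ++ s2) & all (fun e => m <= e.1.2) (s1 ++ s2)].
  by rewrite /admissible; case: s1 => [|? ?] //; case: s2 s2_gt0.
by rewrite !all_cat /= -!andbA; do 2!congr (_ && _); do !bool_congr.
Qed.

Lemma admissible_weaken m m' R R' s :
  m' <= m -> R <= R' -> admissible m R s -> admissible m' R' s.
Proof.
move=> mm RR /and3P [h sR sm]; apply/and3P; split=> //.
  by apply: sub_all sR => e /= /leq_trans; apply.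
by apply: sub_all sm => e /=; apply: leq_trans.
Qed.

Lemma admissible_update m R s1 a x x' s2 : len x' <= len x ->
  admissible m R (s1 ++ (a, x) :: s2) -> admissible m R (s1 ++ (a, x') :: s2).
Proof.
move=> lx; case: s1 => [|e s1].
  rewrite /admissible /=; case: s2 => // e s2 /and3P [-> /andP [xR ->] ->].
  by rewrite (leq_trans lx xR).
rewrite !admissible_cat //= => /and5P [-> -> -> /andP [xR ->] ->].
by rewrite (leq_trans lx xR).
Qed.

(** By induction on [K], removing one letter at a time.  A deletion counts as
    close to an entry if it is less than k periods away, where k is so large that
    a power of P split in two such parts is still large; absorbing it increases
    the length of the entry by at most k + 1 periods. *)
Theorem large_exponents_clustered K R :
  exists m, forall s, admissible m R s -> N (val s) <= K -> clustered s.
Proof.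
elim: K R => [|K IH] R.
  exists (4 * R + 6)%N => s gs; rewrite leqn0 => /eqP v0; exists s.
  split; rewrite ?sdistxx //; apply: trivial_block_prod gs _.
  exact: conj_norm0.
have [m1 H1] := IH (R + size P)%N.
pose k := (m1 + K + 2)%N.
have [m2 H2] := IH (R + k.+1 * size P)%N.
exists (k + m1 + m2 + 1)%N => s gs.
rewrite leq_eqVlt => /orP [/eqP NK|lt]; last first.
  by apply: H1 => //; apply: admissible_weaken gs; lia.
have [v dv Nv] : exists2 v, one_deletion (block_word s) v & N (fmk v) <= K.
  by apply: conj_norm_one_deletion; rewrite fmk_block_word.
case: (one_deletion_block_word dv) => [[s1 [a [x [s2 [x' [sE lx dx vE]]]]]]|].
  subst s; rewrite vE in Nv.
  apply: (@clustered_step _ (s1 ++ (a, x') :: s2)).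
  - by rewrite !frame_cat.
  - by rewrite sdist_cat // sdist_cons !sdistxx NK; norm_lia.
  - by apply: H1 => //; apply: admissible_weaken (admissible_update lx gs); lia.
case=> s1 [b [i [j [c [x [s2 [sE lc dc vE]]]]]]]; subst s.
have s1_gt0 : 0 < size s1.
  by case: (s1) gs => //; case: (s2) => // e s3; rewrite /admissible /= addnS.
have valE s0 a x0 : s1 = rcons s0 (a, x0) ->
    val (s0 ++ (a, x0 * signed b ^+ i * c) :: (b, j, x) :: s2) = fmk v.
  by move=> sE; rewrite vE sE -cats1 !val_cat /= !mulgA mulg1.
have gs' := gs; move: gs'; rewrite admissible_cat // => /and5P [hd sR sm].
rewrite /= => /andP [xR s2R] /andP [nm s2m].
have allR l R1 R2 : all (fun e => len e.2 <= R1) l -> R1 <= R2 ->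
    all (fun e => len e.2 <= R2) l.
  by move=> lR RR; apply: sub_all lR => e /= /leq_trans; apply.
have allm l (n1 n2 : nat) : all (fun e => n1 <= e.1.2) l -> n2 <= n1 ->
    all (fun e : block => n2 <= e.1.2) l.
  by move=> ln nn; apply: sub_all ln => e /=; apply: leq_trans.
have kP : (k.+1 * size P = k * size P + size P)%N by rewrite mulSn addnC.
have [ik|ki] := ltnP i k.
  have ip : (i * size P <= k * size P)%N by rewrite leq_mul2r (ltnW ik) orbT.
  case: (lastP s1) valE gs s1_gt0 hd sR sm vE NK {dv} => // s0 [a x0] valE gs _ hd sR sm vE NK.
  rewrite cat_rcons in NK *; apply: clustered_absorb_left dc _ _;
    rewrite ?(valE _ _ _ (erefl _)) ?NK //.
  apply: H2; last by rewrite (valE _ _ _ (erefl _)).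
  rewrite -cat_rcons admissible_cat ?size_rcons //; apply/and5P; split.
  - by case: (s0) hd.
  - move: sR; rewrite !all_rcons /= => /andP [x0R s0R]; apply/andP; split.
      apply: leq_trans (lenM _ _) _; rewrite kP addnA; apply: leq_add => //.
      apply: leq_trans (lenM _ _) _; apply: leq_add => //.
      exact: leq_trans (len_signedX _ _) ip.
    exact: allR s0R (leq_addr _ _).
  - case: (s0) sm => //= e s3; rewrite !all_rcons /= => /andP [am sm].
    by apply/andP; split; [lia | apply: allm sm _; lia].
  - by apply/andP; split; [rewrite /=; lia | apply: allR s2R (leq_addr _ _)].
  - by apply/andP; split; [rewrite /=; lia | apply: allm s2m _; lia].
have [jk|kj] := ltnP j k.
  have jp : (j * size P <= k * size P)%N by rewrite leq_mul2r (ltnW jk) orbT.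
  have valE' : val (s1 ++ (b, i, c * signed b ^+ j * x) :: s2) = fmk v.
    by rewrite vE val_cat /= !mulgA.
  apply: clustered_absorb_right dc _ _; rewrite ?valE' ?NK //.
  apply: H2; last by rewrite valE'.
  rewrite admissible_cat //; apply/and5P; split=> //.
  - exact: allR sR (leq_addr _ _).
  - by apply: allm sm _; lia.
  - apply/andP; split; last by apply: allR s2R (leq_addr _ _).
    apply: leq_trans (lenM _ _) _; rewrite /= addnC; apply: leq_add => //.
    apply: leq_trans (lenM _ _) _; rewrite mulSn; apply: leq_add => //.
    exact: leq_trans (len_signedX _ _) jp.
  - by apply/andP; split; [rewrite /=; lia | apply: allm s2m _; lia].
have valE' : val (s1 ++ (b, i, c) :: (b, j, x) :: s2) = fmk v.
  by rewrite vE val_cat /= !mulgA.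
apply: (clustered_split dc s1_gt0 _ NK _ (K := K)); rewrite ?valE' //.
- by rewrite /k in ki; lia.
- move=> n nij Nn; apply: H1 Nn; rewrite admissible_cat //; apply/and5P; split=> //.
  + exact: allR sR (leq_addr _ _).
  + by apply: allm sm _; lia.
  + by apply/andP; split; [rewrite /=; lia | apply: allR s2R (leq_addr _ _)].
  + by apply/andP; split; [rewrite /=; lia | apply: allm s2m _; lia].
apply: H1; last by rewrite valE'.
rewrite admissible_cat //; apply/and5P; split=> //.
- exact: allR sR (leq_addr _ _).
- by apply: allm sm _; lia.
- by apply/and3P; split; [rewrite /=; lia | rewrite /=; lia | apply: allR s2R (leq_addr _ _)].
- by apply/and3P; split; [rewrite /=; lia | rewrite /=; lia | apply: allm s2m _; lia].
Qed.

End Blocks.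

(** * Slides and the growth of the norm *)
Section Slides.
Local Open Scope group_scope.
Variable S : choiceType.
Local Notation F := (freeGroup S).
Local Notation N := (@conj_norm S).
Implicit Types (x y z g h c D e : F) (a b : letter S) (f psi : S -> int).

(** The three entries of the block product are x, h and 1, so h is the only
    interior one, and z is the element commuting with D by which it is replaced.
    A conjugation makes D cyclically reduced beforehand. *)
Lemma conj_norm_far_conj f D x h : (forall s, `|f s|%N <= 1) -> `|expsum f D|%N = 1%N ->
  exists n (b : bool) j, let z := (if b then D^-1 else D) ^+ j in
    N (x * z) + dist h z <= N (x * h ^ (D ^+ n)^-1).
Proof.
move=> f1 fD; have D1 : D <> 1 by move=> D1; move: fD; rewrite D1 expsum1.
have [v [P [_ rP DE]]] := cyclic_reduction D1.
have fP : `|word_wt f P|%N = 1%N by rewrite -expsum_fmk -fD DE expsumJ.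
set x' := x ^ v^-1; set h' := h ^ v^-1.
have [m H] := large_exponents_clustered f1 rP fP (N x + N h) (len x' + len h').
pose s : seq (block S) := [:: (false, 0%N, x'); (false, m, h'); (true, m, 1)].
have vs : block_prod P s = (x * h ^ (D ^+ m)^-1) ^ v^-1.
  rewrite /= !mulg1 conjMg -/x' expg0 mul1g; congr (_ * _).
  rewrite -conjgM DE -conjXg.
  have -> : ((fmk P ^+ m) ^ v)^-1 * v^-1 = v^-1 * (fmk P ^+ m)^-1.
    by rewrite conjgE !invgM invgK -!mulgA mulgV mulg1.
  by rewrite conjgM -/h' conjgE invgK expVgn -mulgA.
have gs : admissible m (len x' + len h') s.
  by rewrite /admissible /= leq_addr leq_addl leqnn /= /len /=.
have [|t [tE [i [i0 iS com]] le]] := H s gs.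
  rewrite vs conj_normJ; apply: leq_trans (conj_normM _ _) _.
  by rewrite conj_normJ.
rewrite vs conj_normJ in le.
case: t tE i0 iS com le => [|[a0 y0] [|[a1 y1] [|[a2 y2] [|? ?]]]] //= [<- <- <-].
case: i => [|[|i]] //= _ _ com; rewrite addn0.
have [b [j zE]] := centralizer rP fP com.
have -> : fmk P ^+ 0 * y0 * (fmk P ^+ m * y1 * ((fmk P)^-1 ^+ m * y2 * 1)) = y0 * y1 * y2.
  rewrite expg0 mul1g mulg1 expVgn -!mulgA; congr (_ * _).
  have cm : commute y1 (fmk P ^+ m) by apply/commuteX/commute_sym.
  by rewrite mulgA -cm -mulgA mulVKg.
move=> le; exists m, b, j; set z := (X in N (x * X)); rewrite /=.
have zv : z = y1 ^ v.
  by rewrite /z zE conjXg DE; case: (b); rewrite ?conjVg.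
have -> : N (x * z) = N (x' * y1).
  by rewrite -(conj_normJ (x' * y1) v) conjMg -conjgM mulVg conjg1 zv.
have -> : dist h z = dist h' y1.
  by rewrite /dist zv -(conj_normJ (h'^-1 * y1) v) conjMg conjVg -conjgM mulVg conjg1.
have d1 := conj_norm_dist (y0 * y1 * y2) (x' * y1 * 1).
have d2 := distM (y0 * y1) (x' * y1) y2 1.
rewrite distMr (distC y0) (distC y2) in d2; rewrite mulg1 in d1.
move: le d1 d2; rewrite mulg1; norm_lia.
Qed.

Lemma conj_norm_expX n g : N (g ^+ n) <= n * N g.
Proof.
elim: n => [|n IH]; first by rewrite expg0 conj_norm1.
by rewrite expgS mulSn; apply: leq_trans (conj_normM _ _) _; rewrite leq_add2l.
Qed.

(** Let D = u e.  The bound |x D^j| + |e D^j| of [conj_norm_far_conj] exceeds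
    |x|: the exponent sum psi gives |e D^j| >= |3j + 1|, and D changes norms by at
    most 3.  This leaves room except for j < 0, where the first of the factors
    D^-1 lowers the norm of x by at most 1, because x D^-1 = x^-1 e1. *)
Lemma conj_norm_slide f psi x e1 (u e : F) : conj_gen e1 -> conj_gen e -> N (u * e) <= 3 ->
  x * x = e1 * (u * e) ->
  (forall s, `|f s|%N <= 1) -> `|expsum f (u * e)%g|%N = 1%N ->
  (forall s, `|psi s|%N <= 1) -> expsum psi (u * e) = Posz 3 -> expsum psi e = Posz 1 ->
  exists n, N (x * e^-1 ^ ((u * e) ^+ n)^-1) = (N x).+1.
Proof.
move=> ce1 ce; set D := u * e => ND xx f1 fD psi1 psiD psie.
have [n [b [j /= lim]]] := conj_norm_far_conj x e^-1 f1 fD.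
exists n; apply/eqP; rewrite eqn_leq; apply/andP; split.
  apply: leq_trans (conj_normM _ _) _; rewrite -addn1 leq_add2l.
  exact/conj_norm_gen/conj_genJ/conj_genV.
move: lim; rewrite /dist invgK => lim.
have NDX i : N (D ^+ i) <= 3 * i.
  by apply: leq_trans (conj_norm_expX _ _) _; rewrite mulnC leq_mul2r ND orbT.
case: b lim => lim; last first.
  have : 3 * j + 1 <= N (e * D ^+ j).
    apply: leq_trans (expsum_le_norm _ psi1).
    by rewrite expsumM expsumX psie psiD -GRing.mulr_natr natz; lia.
  have := conj_normM (x * D ^+ j) (D ^+ j)^-1; rewrite mulgK conj_normV.
  have := NDX j; norm_lia.
case: j lim => [|i] lim.
  have : 1 <= N (e * 1).
    apply: leq_trans (expsum_le_norm _ psi1).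
    by rewrite mulg1 psie.
  move: lim; rewrite !expg0 !mulg1; norm_lia.
have : 3 * i + 2 <= N (e * D^-1 ^+ i.+1).
  apply: leq_trans (expsum_le_norm _ psi1).
  by rewrite expsumM expsumX psie expsumV psiD -GRing.mulr_natr natz; lia.
have xD : x * D^-1 = x^-1 * e1.
  apply: (mulgI x); apply: (mulIg D); rewrite mulVKg (mulgA x) mulgVK.
  by [].
have l1 := conj_normM (x * D^-1 ^+ i.+1) (D ^+ i).
have l2 := conj_normM (x^-1 * e1) e1^-1.
rewrite mulgK !conj_normV in l2.
have E : x * D^-1 ^+ i.+1 * D ^+ i = x^-1 * e1 by rewrite expgS mulgA expVgn mulgVK.
rewrite E in l1; have := NDX i; have := conj_norm_gen ce1; norm_lia.
Qed.

Definition conj_letter a e := exists y, e = fmk [:: a] ^ y.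

Definition square_factors (a b c d : letter S) x := exists e1 e2 e3 e4,
  [/\ x * x = e1 * (e2 * e3 * e4), conj_letter a e1, conj_letter b e2,
      conj_letter c e3 & conj_letter d e4].

Lemma conj_letterJ a e y : conj_letter a e -> conj_letter a (e ^ y).
Proof. by case=> z ->; exists (z * y); rewrite conjgM. Qed.

Lemma conj_letterV a e : conj_letter a e -> conj_letter (linv a) e^-1.
Proof. by case=> z ->; exists z; rewrite fmk_linv conjVg. Qed.

Lemma conj_letter_gen a e : conj_letter a e -> conj_gen e.
Proof. by case=> z ->; apply: conj_gen_letter. Qed.

Lemma expsum_conj_letter f a e : conj_letter a e -> expsum f e = letter_wt f a.
Proof. by case=> z ->; rewrite expsumJ expsum_letter. Qed.

(** The twisted factors are conjugates by a power of their product D, so they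
    have the same product; the last one is then moved to the front through x,
    where it appears inverted. *)
Lemma slide f psi (a b c d : letter S) x : square_factors a b c d x ->
  (forall s, `|f s|%N <= 1) ->
  `|(letter_wt f b + letter_wt f c + letter_wt f d)%R|%N = 1%N ->
  (forall s, `|psi s|%N <= 1) ->
  letter_wt psi b = Posz 1 -> letter_wt psi c = Posz 1 -> letter_wt psi d = Posz 1 ->
  exists2 x', square_factors (linv d) a b c x' & N x' = (N x).+1.
Proof.
case=> e1 [e2 [e3 [e4 [xx c1 c2 c3 c4]]]] f1 fD psi1 pb pc pd.
have [|||||n NE] := @conj_norm_slide f psi x e1 (e2 * e3) e4
  (conj_letter_gen c1) (conj_letter_gen c4) _ xx f1.
- apply: leq_trans (conj_normM _ _) _; rewrite -[3]/(2 + 1)%N; apply: leq_add.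
    apply: leq_trans (conj_normM _ _) _; rewrite -[2]/(1 + 1)%N; apply: leq_add;
    apply: conj_norm_gen; [exact: conj_letter_gen c2 | exact: conj_letter_gen c3].
  exact/conj_norm_gen/(conj_letter_gen c4).
- by rewrite !expsumM (expsum_conj_letter f c2) (expsum_conj_letter f c3)
    (expsum_conj_letter f c4).
- by [].
- by rewrite !expsumM (expsum_conj_letter _ c2) (expsum_conj_letter _ c3)
    (expsum_conj_letter _ c4) pb pc pd.
- by rewrite (expsum_conj_letter _ c4).
set D := e2 * e3 * e4 in xx NE; set q := (D ^+ n)^-1 in NE.
exists (x * e4^-1 ^ q) => //.
exists ((e4^-1 ^ q) ^ x^-1), e1, (e2 ^ q), (e3 ^ q); split=> //.
- have Dq : D = D ^ q.
    rewrite conjgE /q invgK; have/commuteX := commute_refl D; move=> /(_ n) cD.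
    by rewrite mulgA -cD mulgK.
  have E : x * x = e1 * (e2 ^ q * e3 ^ q * e4 ^ q) by rewrite xx {1}Dq /D !conjMg.
  have -> : x * e4^-1 ^ q * (x * e4^-1 ^ q) = (e4^-1 ^ q) ^ x^-1 * (x * x) * e4^-1 ^ q.
    by rewrite (conjgE _ x^-1) invgK !mulgA mulgVK.
  rewrite E (conjVg e4 q); move: (e2 ^ q) (e3 ^ q) (e4 ^ q) (_ ^ x^-1) => ? ? ? ?.
  by rewrite !mulgA mulgK.
- by do 2!apply: conj_letterJ; apply: conj_letterV.
- exact: conj_letterJ.
- exact: conj_letterJ.
Qed.


Definition letter_sign a : int := (if a.2 then -1 else 1)%R.

Definition indicator (s : S) : S -> int := fun r => (r == s)%:R%R.

(** The weights for which both letters [a] and [b] count as +1. *)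
Definition signed_pair a b : S -> int := fun r =>
  if r == a.1 then letter_sign a else if r == b.1 then letter_sign b else 0%R.

Lemma indicator_le1 s r : `|indicator s r|%N <= 1.
Proof. by rewrite /indicator; case: (r == s). Qed.

Lemma signed_pair_le1 a b r : `|signed_pair a b r|%N <= 1.
Proof. by rewrite /signed_pair /letter_sign; do 2!case: (r == _); rewrite //; case: ifP. Qed.

Lemma letter_wt_indicator a : `|letter_wt (indicator a.1) a|%N = 1%N.
Proof. by rewrite /letter_wt /indicator eqxx; case: a.2. Qed.

Lemma letter_wt_indicator0 s b : s != b.1 -> letter_wt (indicator s) b = 0%R.
Proof.
by rewrite eq_sym /letter_wt /indicator => /negbTE ->; case: b.2; rewrite ?GRing.oppr0.
Qed.

Lemma letter_wt_signed_pairl a b : letter_wt (signed_pair a b) a = Posz 1.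
Proof. by rewrite /letter_wt /signed_pair /letter_sign eqxx; case: a.2. Qed.

Lemma letter_wt_signed_pairr a b : a.1 != b.1 -> letter_wt (signed_pair a b) b = Posz 1.
Proof.
rewrite /letter_wt /signed_pair /letter_sign eq_sym eqxx => /negbTE ->.
by case: b.2.
Qed.

(** Starting from the factor pattern a, a, b, b, two slides lead to the pattern
    b^-1, b^-1, a, a, which has the same form.  The intermediate pattern
    b^-1, a, a, b contains b^-1 and b, but the product D of the last three factors
    omits b^-1, so both exponent sums of D are as large as three factors permit.
    Moreover one of them is 1 up to sign, as required for f. *)
Lemma slide_aabb a b x : a.1 != b.1 -> square_factors a a b b x ->
  exists2 x', square_factors (linv b) a a b x' & N x' = (N x).+1.
Proof.
move=> ab sq; apply: (@slide (indicator a.1) (signed_pair a b) _ _ _ _ _ sq).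
- exact: indicator_le1.
- by rewrite !(letter_wt_indicator0 ab) !GRing.addr0 letter_wt_indicator.
- exact: signed_pair_le1.
- exact: letter_wt_signed_pairl.
- exact: letter_wt_signed_pairr.
- exact: letter_wt_signed_pairr.
Qed.

Lemma slide_Baab a b x : a.1 != b.1 -> square_factors (linv b) a a b x ->
  exists2 x', square_factors (linv b) (linv b) a a x' & N x' = (N x).+1.
Proof.
move=> ab sq; apply: (@slide (indicator b.1) (signed_pair a b) _ _ _ _ _ sq).
- exact: indicator_le1.
- have ba : b.1 != a.1 by rewrite eq_sym.
  by rewrite !(letter_wt_indicator0 ba) !GRing.add0r letter_wt_indicator.
- exact: signed_pair_le1.
- exact: letter_wt_signed_pairl.
- exact: letter_wt_signed_pairl.
- exact: letter_wt_signed_pairr.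
Qed.

(** The starting point is x = s t, with x^2 = s (t s t^-1) t t. *)
Lemma bounded_square_any_norm (r s t : S) m : r != s -> r != t -> s != t -> 2 <= m ->
  exists x, [/\ N x = m, N (x * x) <= 4 & expsum (indicator r) x = 0%R].
Proof.
move=> rs rt st m2.
pose x0 := gen s * gen t.
have N0 : N x0 <= 2.
  apply: leq_trans (conj_normM _ _) _; rewrite -[2]/(1 + 1)%N.
  by apply: leq_add; apply: conj_norm_gen; [exists s, 1 | exists t, 1]; rewrite conjg1; left.
have [x [a [b [ra rb ab sq Nx]]]] : exists x a b, [/\ r != a.1, r != b.1, a.1 != b.1,
    square_factors a a b b x \/ square_factors (linv b) a a b x & N x = (N x0 + (m - N x0))%N].
  elim: (m - N x0)%N => [|k [x [a [b [ra rb ab [sq|sq] Nx]]]]].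
  - exists x0, (s, false), (t, false); split=> //; last by rewrite addn0.
    left; exists (gen s), (gen s ^ (gen t)^-1), (gen t), (gen t); split.
    + by rewrite /x0 conjgE invgK !mulgA mulgVK.
    + by exists 1; rewrite conjg1.
    + by exists (gen t)^-1.
    + by exists 1; rewrite conjg1.
    + by exists 1; rewrite conjg1.
  - have [x' sq' Nx'] := slide_aabb ab sq.
    by exists x', a, b; split=> //; [right | rewrite Nx' Nx addnS].
  - have [x' sq' Nx'] := slide_Baab ab sq.
    exists x', (linv b), a; split=> //; last by rewrite Nx' Nx addnS.
      by rewrite eq_sym.
    by left.
exists x; split; first by rewrite Nx subnKC // (leq_trans N0).
- have [e1 [e2 [e3 [e4 [-> c1 c2 c3 c4]]]]] : exists e1 e2 e3 e4, 
      [/\ x * x = e1 * (e2 * e3 * e4), conj_gen e1, conj_gen e2, conj_gen e3 & conj_gen e4].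
    by case: sq => -[e1 [e2 [e3 [e4 [xx c1 c2 c3 c4]]]]]; exists e1, e2, e3, e4; split=> //;
      apply: conj_letter_gen; eassumption.
  have := conj_normM e1 (e2 * e3 * e4); have := conj_normM (e2 * e3) e4.
  have := conj_normM e2 e3; move: (conj_norm_gen c1) (conj_norm_gen c2) (conj_norm_gen c3).
  move: (conj_norm_gen c4); norm_lia.
have : expsum (indicator r) (x * x) = 0%R.
  by case: sq => -[e1 [e2 [e3 [e4 [-> c1 c2 c3 c4]]]]];
    rewrite !expsumM !(expsum_conj_letter _ c1, expsum_conj_letter _ c2,
      expsum_conj_letter _ c3, expsum_conj_letter _ c4) !letter_wt_indicator0.
rewrite expsumM; lia.
Qed.

Lemma expsum_gen f s : expsum f (gen s) = f s.
Proof. by rewrite -[gen s]/(fmk [:: (s, false)]) expsum_letter. Qed.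

Lemma conj_norm_genX s k : N (gen s ^+ k) = k.
Proof.
apply/eqP; rewrite eqn_leq; apply/andP; split.
  apply: leq_trans (conj_norm_expX _ _) _; rewrite -{2}(muln1 k) leq_mul2l.
  by apply/orP; right; apply: conj_norm_gen; exists s, 1; left; rewrite conjg1.
have := @expsum_le_norm _ (indicator s) (gen s ^+ k) (indicator_le1 s).
by rewrite expsumX expsum_gen /indicator eqxx GRing.mulr1n natz.
Qed.

End Slides.

Theorem theorem1p2 (n : nat) (hn : 2 <= n) :
  exists g : freeGroup 'I_(4 * n - 3),
    (n ^ 2 - n + 1 <= conj_norm g <= 4 * n ^ 2 - 8 * n + 5) /\
    (2 * n <= conj_norm (g ^+ 2)%g <= 8 * n - 4).
Proof.
have lt0 : 0 < 4 * n - 3 by lia.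
have lt1 : 1 < 4 * n - 3 by lia.
have lt2 : 2 < 4 * n - 3 by lia.
pose r := Ordinal lt0; pose s := Ordinal lt1; pose t := Ordinal lt2.
have [n2|n3] := leqP n 2.
  exists (gen r ^+ 3)%g; rewrite -expgnA !conj_norm_genX.
  by have -> : n = 2 by lia.
have [x [Nx Nxx xr]] := @bounded_square_any_norm _ r s t (n ^ 2 + 1) isT isT isT ltac:(lia).
pose y : freeGroup _ := (gen r ^+ n)%g.
have Ny : conj_norm y = n by apply: conj_norm_genX.
exists (x * y)%g; split.
  have h1 := conj_normM x y.
  have h2 := conj_normM (x * y)%g y^-1%g; rewrite mulgK conj_normV in h2.
  rewrite Nx Ny -mulnn in h1 h2; rewrite -mulnn.
  have nn : 3 * n <= n * n by rewrite leq_mul2r n3 orbT.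
  by move: h1 h2 nn; move: (conj_norm _) (n * n) => N m; lia.
apply/andP; split.
  have := @expsum_le_norm _ (indicator r) ((x * y) ^+ 2)%g (indicator_le1 r).
  rewrite expsumX expsumM xr expsumX expsum_gen /indicator eqxx GRing.mulr1n natz.
  by rewrite GRing.add0r GRing.mulr2n; move: (conj_norm _) => N; lia.
have -> : ((x * y) ^+ 2 = x * x * (y ^ x * y))%g by rewrite expg2 conjgE !mulgA mulgK.
have h1 := conj_normM (x * x)%g (y ^ x * y)%g.
have h2 := conj_normM (y ^ x)%g y; rewrite conj_normJ Ny in h2.
norm_lia.
Qed.
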